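(* Let $S$ be a compact oriented closed surface of genus $g>1$ (hyperbolic case), respectively $g=1$ (Euclidean case), with a triangulation $\mathcal T$ having vertex set $V=\{v_1,\dots,v_N\}$ and edge set $E$. Let $\Theta:E\to(0,\pi)$ be an angle function satisfying condition $(\mathbf{C1})$: for any distinct edges $e_1,\dots,e_m$ forming the boundary of a 2-cell of $\mathcal T$, $\sum_{i=1}^m\Theta(e_i)=(m-2)\pi$. Let $K_1,\dots,K_N:\mathbb R_+^N\to\mathbb R$ be the discrete curvatures, as functions of the radius vector $r=(r_1,\dots,r_N)$, in the corresponding background geometry. (Hyperbolic case.) Let $\overline K=(k_1,\dots,k_N)\in\mathbb R^N$ be hyperbolic attainable. Then for every initial radius vector $r(0)\in\mathbb R_+^N$ the flow $$\frac{dr_i}{dt}=\sum_{j=1}^N (k_j-K_j)\,\frac{\partial K_j}{\partial r_i}\,\sinh^2 r_i\qquad(i=1,\dots,N)$$ exists for all time $t\in[0,+\infty)$ and converges exponentially fast to a radius vector $r^*\in\mathbb R_+^N$ which produces a hyperbolic ideal circle pattern metric on $S$ whose discrete curvatures are assigned by $\overline K$, i.e. $K_i(r^* )=k_i$ for all $i$. (Euclidean case.) Let $\overline K=(k_1,\dots,k_N)\in\mathbb R^N$ be Euclidean attainable. Then for every initial radius vector $r(0)\in\mathbb R_+^N$ the flow $$\frac{dr_i}{dt}=\sum_{j=1}^N (k_j-K_j)\,\frac{\partial K_j}{\partial r_i}\,r_i^2\qquad(i=1,\dots,N)$$ exists for all time $t\in[0,+\infty)$ and converges exponentially fast to a radius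 vector $r^*\in\mathbb R_+^N$ which produces a Euclidean ideal circle pattern metric on $S$ whose discrete curvatures are assigned by $\overline K$, i.e. $K_i(r^* )=k_i$ for all $i$.
   Context: $\mathbb R_+=(0,+\infty)$. A radius vector $r=(r_1,\dots,r_N)\in\mathbb R_+^N$ assigns to each vertex $v_i$ the radius $r_i$. For each edge $[v_i,v_j]\in E$ define the length $$l_{ij}=\cosh^{-1}\big(\cosh r_i\cosh r_j+\sinh r_i\sinh r_j\cos\Theta([v_i,v_j])\big)$$ in hyperbolic background geometry, and $$l_{ij}=\sqrt{r_i^2+r_j^2+2r_ir_j\cos\Theta([v_i,v_j])}$$ in Euclidean background geometry. There is a unique (up to isometry) hyperbolic (resp. Euclidean) geodesic triangle with side lengths $l_{ij},r_i,r_j$; its vertices are the centers $v_i,v_j$ and an intersection point of the circles of radii $r_i,r_j$ about $v_i,v_j$ (the side $l_{ij}$ joins $v_i$ to $v_j$, and the side $r_i$, resp. $r_j$, joins $v_i$, resp. $v_j$, to the intersection point). Each edge gives two copies of this triangle, one on each side of the edge. Gluing all these triangles along common edges gives a hyperbolic (resp. Euclidean) metric on $S$, with possible cone singularities at the vertices of $\mathcal T$, called the hyperbolic (resp. Euclidean) ideal circle pattern metric produced by $r$. The discrete curvature at $v_i$ is $K_i=2\pi-\sigma(v_i)$, where $\sigma(v_i)$ is the sum of the inner angles at $v_i$ of all these triangles incident to $v_i$. Each $K_i$ is a smooth function of $r\in\mathbb R_+^N$. A vector $\overline K=(k_1,\dots,k_N)\in\mathbb R^N$ is called hyperbolic attainable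 if $k_i<2\pi$ for all $i$ and $$\sum_{v_i\in A}k_i>2\pi|A|-2\sum_{e\in E,\ \partial e\cap A\neq\emptyset}\Theta(e)$$ for every non-empty subset $A$ of $V$. It is called Euclidean attainable if $k_i<2\pi$ for all $i$ and $$\sum_{v_i\in A}k_i\ge 2\pi|A|-2\sum_{e\in E,\ \partial e\cap A\neq\emptyset}\Theta(e)$$ for every non-empty subset $A$ of $V$, where equality holds if and only if $A=V$. Here $\partial e$ denotes the set of endpoints of $e$. ''Converges exponentially fast to $r^*$'' means that there are constants $C,\lambda>0$ with $\|r(t)-r^*\|\le Ce^{-\lambda t}$ for all $t\ge0$. *)

(* Defs.v *)
From HB Require Import structures.
From mathcomp Require Import all_boot all_order all_algebra.
From mathcomp Require Import all_classical all_reals all_analysis.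

Set Implicit Arguments.
Unset Strict Implicit.
Unset Printing Implicit Defensive.

Import Order.TTheory GRing.Theory Num.Theory.
Import numFieldNormedType.Exports.

Local Open Scope classical_set_scope.
Local Open Scope ring_scope.

(* A triangulation of a connected closed oriented surface, encoded as a
   combinatorial map.  Each edge e carries two darts, (e, true) and (e, false),
   one for each of its orientations.  The face on the left of a dart is its
   orbit under [tri_next], which follows the face boundary in the positive
   sense; since next (rev d) leaves the vertex that d leaves, the orbits of
   next \o rev are the stars of the vertices.  Loops and multiple edges are
   allowed; simplicial triangulations are a special case. *)
Definition dart_rev (E : finType) (d : E * bool) : E * bool := (d.1, ~~ d.2).

Record triangulation (N : nat) := Triangulation {
  tri_edge : finType;
  tri_next : tri_edge * bool -> tri_edge * bool;
  tri_src : tri_edge * bool -> 'I_N;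
  tri_nonempty : (0 < #|tri_edge|)%N;
  tri_next_inj : injective tri_next;
  tri_face3 : forall d, fingraph.order tri_next d = 3%N;
  tri_src_surj : forall i : 'I_N, exists d, tri_src d = i;
  tri_srcP : forall d d',
    tri_src d = tri_src d' <->
    fconnect (tri_next \o @dart_rev tri_edge) d d';
  tri_connected : forall d d',
    connect [rel x y | (y == tri_next x) || (y == dart_rev x)] d d'
}.

(* V - E + F; it equals 2 - 2g on a surface of genus g *)
Definition euler_char (N : nat) (T : triangulation N) : int :=
  N%:Z - #|tri_edge T|%:Z + (fcard (@tri_next _ T) predT)%:Z.

Definition tri_tgt (N : nat) (T : triangulation N) (d : tri_edge T * bool) :
  'I_N := tri_src (dart_rev d).

Definition edge_ends (N : nat) (T : triangulation N) (e : tri_edge T) :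
  {set 'I_N} := [set tri_src (e, true); tri_src (e, false)]%SET.

Definition face_edges (N : nat) (T : triangulation N)
  (d : tri_edge T * bool) : seq (tri_edge T) :=
  [seq x.1 | x <- orbit (@tri_next _ T) d].

Definition cond_C1 (R : realType) (N : nat) (T : triangulation N)
  (Theta : tri_edge T -> R) : Prop :=
  forall d : tri_edge T * bool, uniq (face_edges d) ->
    \sum_(e <- face_edges d) Theta e = ((size (face_edges d))%:R - 2) * pi.

Definition cosh (R : realType) (x : R) : R := (expR x + expR (- x)) / 2.
Definition sinh (R : realType) (x : R) : R := (expR x - expR (- x)) / 2.
Definition arcosh (R : realType) (x : R) : R := ln (x + Num.sqrt (x ^+ 2 - 1)).

Lemma arcosh_ge0 (R : realType) (x : R) : 1 <= x -> 0 <= arcosh x.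
Proof.
move=> x1; rewrite /arcosh ln_ge0//.
by rewrite (le_trans x1)// lerDl sqrtr_ge0.
Qed.

Lemma arcoshK (R : realType) (x : R) : 1 <= x -> cosh (arcosh x) = x.
Proof.
move=> x1; rewrite /cosh /arcosh; set s := Num.sqrt _.
have s0 : 0 <= s by exact: sqrtr_ge0.
have sE : s * s = x ^+ 2 - 1.
  by rewrite -expr2 sqr_sqrtr// subr_ge0 expr_ge1// (le_trans ler01).
have xs0 : 0 < x + s by rewrite ltr_wpDr// (lt_le_trans ltr01).
have vE : (x + s)^-1 = x - s.
  apply: (mulfI (lt0r_neq0 xs0)); rewrite divff ?gt_eqF//.
  by rewrite mulrC -subr_sqr (expr2 s) sE subKr.
by rewrite expRN lnK ?posrE// vE addrACA subrr addr0 mulrDl -splitr.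
Qed.

Inductive background := Hyperbolic | Euclidean.

(* length of an edge with angle th whose endpoints have radii a and b *)
Definition edge_length (R : realType) (bg : background) (th a b : R) : R :=
  match bg with
  | Hyperbolic => arcosh (cosh a * cosh b + sinh a * sinh b * cos th)
  | Euclidean => Num.sqrt (a ^+ 2 + b ^+ 2 + 2 * a * b * cos th)
  end.

(* In the geodesic triangle with side lengths a, b, c, the inner angle between
   the sides a and b (opposite to c), by the law of cosines. *)
Definition inner_angle (R : realType) (bg : background) (a b c : R) : R :=
  match bg with
  | Hyperbolic => acos ((cosh a * cosh b - cosh c) / (sinh a * sinh b))
  | Euclidean => acos ((a ^+ 2 + b ^+ 2 - c ^+ 2) / (2 * a * b))
  end.

(* The inner angle at the source of d of either of the two congruent triangles
   erected on the edge of d. *)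
Definition dart_angle (R : realType) (bg : background) (N : nat)
  (T : triangulation N) (Theta : tri_edge T -> R) (r : 'rV[R]_N)
  (d : tri_edge T * bool) : R :=
  let a := r 0 (tri_src d) in
  let b := r 0 (tri_tgt d) in
  inner_angle bg (edge_length bg (Theta d.1) a b) a b.

(* The sum is over the darts leaving vertex i, so that a loop at i contributes
   at both of its ends; the factor 2 counts the two copies of each triangle. *)
Definition curvature (R : realType) (bg : background) (N : nat)
  (T : triangulation N) (Theta : tri_edge T -> R) (i : 'I_N) (r : 'rV[R]_N) :
  R := 2 * pi - \sum_(d | tri_src d == i) 2 * dart_angle bg Theta r d.

Definition angle_bound (R : realType) (N : nat) (T : triangulation N)
  (Theta : tri_edge T -> R) (A : {set 'I_N}) : R :=
  2 * pi * #|A|%:R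
  - 2 * \sum_(e : tri_edge T | (edge_ends e :&: A != finset.set0)%SET) Theta e.

Definition hyperbolic_attainable (R : realType) (N : nat)
  (T : triangulation N) (Theta : tri_edge T -> R) (k : 'rV[R]_N) : Prop :=
  (forall i, k 0 i < 2 * pi) /\
  (forall A : {set 'I_N}, A <> finset.set0 ->
     \sum_(i in A) k 0 i > angle_bound Theta A).

Definition euclidean_attainable (R : realType) (N : nat)
  (T : triangulation N) (Theta : tri_edge T -> R) (k : 'rV[R]_N) : Prop :=
  (forall i, k 0 i < 2 * pi) /\
  (forall A : {set 'I_N}, A <> finset.set0 ->
     \sum_(i in A) k 0 i >= angle_bound Theta A /\
     (\sum_(i in A) k 0 i = angle_bound Theta A <-> A = [set: 'I_N]%SET)).

Definition positive_vec (R : realType) (N : nat) (r : 'rV[R]_N) : Prop :=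
  forall i, 0 < r 0 i.

Definition flow_weight (R : realType) (bg : background) (x : R) : R :=
  match bg with
  | Hyperbolic => sinh x ^+ 2
  | Euclidean => x ^+ 2
  end.

(* 'D_(delta_mx 0 i) is the partial derivative with respect to r_i. *)
Definition flow_field (R : realType) (bg : background) (N : nat)
  (T : triangulation N) (Theta : tri_edge T -> R) (k r : 'rV[R]_N) (i : 'I_N) :
  R :=
  \sum_(j < N) (k 0 j - curvature bg Theta j r)
    * 'D_(delta_mx 0 i) (curvature bg Theta j) r * flow_weight bg (r 0 i).

(* r is a solution in R_+^N on [0, +oo) with initial value r0.  The time
   derivative is taken relative to [0, +oo), hence one-sided at t = 0; values
   of r at negative times are irrelevant. *)
Definition flow_solution (R : realType) (bg : background) (N : nat)
  (T : triangulation N) (Theta : tri_edge T -> R) (k r0 : 'rV[R]_N)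
  (r : R -> 'rV[R]_N) : Prop :=
  r 0 = r0 /\
  forall t : R, 0 <= t ->
    positive_vec (r t) /\
    forall i : 'I_N,
      (r s 0 i - r t 0 i) / (s - t) @[s --> within [set s : R | 0 <= s] t^']
        --> flow_field bg Theta k (r t) i.

Definition converges_exponentially (R : realType) (N : nat)
  (r : R -> 'rV[R]_N) (rs : 'rV[R]_N) : Prop :=
  exists C lam : R, [/\ 0 < C, 0 < lam &
    forall t : R, 0 <= t -> `|r t - rs| <= C * expR (- lam * t)].

(* Main.v *)
Require Import Defs.
From mathcomp Require Import all_boot all_order all_algebra.
From mathcomp Require Import all_classical all_reals all_analysis.
From mathcomp Require Import ring lra.

Import Order.TTheory GRing.Theory Num.Theory.
Import numFieldNormedType.Exports.

Local Open Scope classical_set_scope.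
Local Open Scope ring_scope.

Set Implicit Arguments.
Unset Strict Implicit.
Unset Printing Implicit Defensive.

(** In the coordinates u_i = ln (tanh (r_i / 2)) (hyperbolic), resp. u_i = ln r_i
(Euclidean), Napier's analogies split the inner angles: with t = tan (Theta / 2)
and g(s) = atan (t tanh (s / 2)), the angle at v_i of a triangle on the edge
[v_i, v_j] is - g(u_i + u_j) - g(u_i - u_j), resp. Theta / 2 - g(u_i - u_j).
Hence L = dK / du is symmetric and positive semidefinite, K is the gradient of
an explicit potential, and the flow becomes u' = - L (K - k).

All the functions involved are bounded and Lipschitz on the whole space, so
global existence follows from Picard iteration; in the hyperbolic case u_i
decreases when it is close to 0, which keeps every radius bounded.  The potential
Phi with gradient K - k decreases along the flow, and attainability makes it
coercive, since Phi is, up to a constant, at least a sum over the superlevel sets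
of - u of the gaps in the attainability inequalities.  So the flow stays in a
compact set, where L >= lam > 0 (in the Euclidean case on vectors of sum zero,
the sum of u being conserved).  Then |K - k|^2 decays exponentially, hence so
does u', and u converges to a zero of K - k.  No a priori existence of a metric
with curvature k is needed. *)

(** The weight in the flow is [(dr/du)^2]: one factor turns the partial derivative in r_i into one
    in u_i, the other turns dr_i/dt into du_i/dt. With the symmetry of L, the flow becomes the
    negative gradient flow of |K - k|^2 / 2 in u. This energy is bounded on the whole space, so its
    decrease cannot confine a trajectory. Phi can: its derivative along the flow is minus the
    quadratic form of L at K - k, and it grows when some u_i tends to minus infinity, that is, when
    a radius degenerates to 0. The opposite degeneration, a hyperbolic radius tending to infinity,
    happens at the finite value u_i = 0, across which K, L and Phi are all smooth; neither function
    detects it, hence the separate barrier argument there. *)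

(** * Differential inequalities and primitives *)

Section Calculus.
Context {R : realType}.
Implicit Types (f g F : R -> R) (x t s : R).

Local Notation is_d f x d := (is_derive x (1 : R) f d).

Lemma is_d_cst (c x : R) : is_d (fun=> c) x 0.
Proof. exact: is_derive_cst. Qed.

Lemma is_d_id x : is_d (fun y => y) x 1.
Proof. exact: is_derive_id. Qed.

Lemma is_d_eq f x a b : is_d f x a -> a = b -> is_d f x b.
Proof. by move=> + <-. Qed.

Lemma is_dD f g x a b : is_d f x a -> is_d g x b ->
  is_d (fun y => f y + g y) x (a + b).
Proof. exact: is_deriveD. Qed.

Lemma is_dN f x a : is_d f x a -> is_d (fun y => - f y) x (- a).
Proof. exact: is_deriveN. Qed.

Lemma is_dB f g x a b : is_d f x a -> is_d g x b ->
  is_d (fun y => f y - g y) x (a - b).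
Proof. exact: is_deriveB. Qed.

Lemma is_dM f g x a b : is_d f x a -> is_d g x b ->
  is_d (fun y => f y * g y) x (f x * b + g x * a).
Proof. exact: is_deriveM. Qed.

Lemma is_dZ (c : R) f x a : is_d f x a -> is_d (fun y => c * f y) x (c * a).
Proof. exact: is_deriveZ. Qed.

Lemma is_d_continuous f x a : is_d f x a -> {for x, continuous f}.
Proof.
by move=> [dx _]; exact/differentiable_continuous/derivable1_diffP.
Qed.

Lemma is_d_comp f g x a b : is_d f x a -> is_d g (f x) b ->
  is_d (fun y => g (f y)) x (b * a).
Proof.
move=> [df <-] [dg <-]; have dfx := proj1 (derivable1_diffP f x) df.
have dgx := proj1 (derivable1_diffP g (f x)) dg.
split; first by apply/derivable1_diffP; exact: differentiable_comp.
by rewrite -!derive1E (derive1_comp df dg).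
Qed.

Lemma is_d_sum (I : finType) (P : pred I) (h : I -> R -> R) (dh : I -> R) x :
  (forall i, is_d (h i) x (dh i)) ->
  is_d (fun y => \sum_(i | P i) h i y) x (\sum_(i | P i) dh i).
Proof.
move=> H.
have -> : (fun y => \sum_(i | P i) h i y) = \sum_(i | P i) h i.
  by apply/funext => y; rewrite fct_sumE.
elim/big_ind2: _ => [|f1 a1 f2 a2 *|i _]; last exact: H.
- exact: is_derive_cst.
- exact: is_deriveD.
Qed.

Lemma dnbhs_epsP (P : R -> Prop) x :
  (\forall s \near x^', P s) <->
  exists2 e, 0 < e & forall s, s != x -> `|s - x| < e -> P s.
Proof.
split=> [[e /= e0 H]|[e e0 H]].
  exists e => // s sx se; apply: H => //=.
  by rewrite distrC.
by exists e => //= s /= se sx; apply: H => //; rewrite distrC.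
Qed.

Lemma is_dP f x d : is_d f x d <->
  forall e, 0 < e -> exists2 dl, 0 < dl &
    forall s, s != x -> `|s - x| < dl -> `|d - (f s - f x) / (s - x)| < e.
Proof.
set q := fun h => h^-1 *: ((f \o shift x) (h *: (1:R)) - f x).
have qE h : q h = (f (h + x) - f x) / ((h + x) - x).
  by rewrite /q /= addrK [h *: _]mulr1 mulrC.
have qP : q @ 0^' --> d <->
    forall e, 0 < e -> exists2 dl, 0 < dl &
    forall s, s != x -> `|s - x| < dl -> `|d - (f s - f x) / (s - x)| < e.
  split=> [/cvgrPdist_lt H e e0|H].
    have [dl dl0 K] := (dnbhs_epsP _ _).1 (H e e0).
    exists dl => // s sx sd.
    have := K (s - x); rewrite qE !subrK subr0 subr_eq0 => /(_ sx sd).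
    by [].
  apply/cvgrPdist_lt => e e0; have [dl dl0 K] := H e e0.
  apply/(dnbhs_epsP _ _).2; exists dl => // h h0; rewrite subr0 => hd.
  by rewrite qE; apply: K; rewrite ?addrK// -subr_eq0 addrK.
split=> [[df dfE]|/qP H].
  by apply/qP; rewrite -dfE; exact: df.
split; first by apply/cvg_ex; exists d.
exact/cvg_lim.
Qed.


Lemma le_of_is_d f df (a b : R) : a <= b ->
  (forall x, a <= x <= b -> is_d f x (df x)) ->
  (forall x, a <= x <= b -> 0 <= df x) -> f a <= f b.
Proof.
move=> ab H H0.
have [||c cab E] := @MVT_segment R f df a b ab.
- by move=> x; rewrite in_itv/= => /andP[/ltW ax /ltW xb]; apply: H; rewrite ax.
- apply: derivable_within_continuous => x; rewrite in_itv/= => xab.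
  by have [] := H x xab.
by rewrite -subr_ge0 E mulr_ge0 ?subr_ge0// H0.
Qed.

Lemma ge_of_is_d f df (a b : R) : a <= b ->
  (forall x, a <= x <= b -> is_d f x (df x)) ->
  (forall x, a <= x <= b -> df x <= 0) -> f b <= f a.
Proof.
move=> ab H H0; rewrite -lerN2.
apply: (@le_of_is_d (fun x => - f x) (fun x => - df x)) => // x xab.
- exact/is_dN/H.
- by rewrite oppr_ge0 H0.
Qed.

Lemma lt_of_is_d f df (a b : R) : a < b ->
  (forall x, a <= x <= b -> is_d f x (df x)) ->
  (forall x, a <= x <= b -> df x < 0) -> f b < f a.
Proof.
move=> ab H H0.
have [||c cab E] := @MVT R f df a b ab.
- by move=> x; rewrite in_itv/= => /andP[/ltW ax /ltW xb]; apply: H; rewrite ax.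
- apply: derivable_within_continuous => x; rewrite in_itv/= => xab.
  by have [] := H x xab.
rewrite -subr_lt0 E pmulr_llt0 ?subr_gt0// H0//.
by move: cab; rewrite in_itv/= => /andP[/ltW -> /ltW ->].
Qed.

(* At an argmax of [f] on an initial interval, [f] would exceed [M] while
   strictly decreasing there. *)
Lemma barrier f df (M : R) : f 0 <= M ->
  (forall t, 0 <= t -> is_d f t (df t)) ->
  (forall t, 0 <= t -> M < f t -> df t < 0) ->
  forall t, 0 <= t -> f t <= M.
Proof.
move=> f0 H H0 t t0.
have [|c cab cmax] := @EVT_max R f 0 t t0.
  apply: derivable_within_continuous => x; rewrite in_itv/= => /andP[x0 _].
  by have [] := H x x0.
apply: (@le_trans _ _ (f c)); first by apply: cmax; rewrite in_itv/= t0 lexx.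
rewrite leNgt; apply/negP => Mc.
move: cab; rewrite in_itv/= => /andP[c0 ct].
have {}c0 : 0 < c.
  by rewrite lt_neqAle c0 andbT; apply/eqP => cE; move: Mc; rewrite -cE ltNge f0.
have /is_d_continuous /cvgrPdist_lt := H c (ltW c0).
move=> /(_ (f c - M)); rewrite subr_gt0 => /(_ Mc) /nbhs_ballP[e /= e0 eb].
pose s := Num.max 0 (c - e / 2).
have sc : s < c by rewrite gt_max c0 ltrBlDr ltrDl divr_gt0.
have s0 : 0 <= s by rewrite le_max lexx.
have : f c < f s.
  apply: (@lt_of_is_d f df) => // x /andP[sx xc].
    by apply: H; exact: le_trans sx.
  apply: H0; first exact: le_trans sx.
  have : ball c e x.
    rewrite /ball/= ger0_norm ?subr_ge0//.
    have : c - e / 2 <= s by rewrite le_max lexx orbT.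
    by move: sx e0; clear; lra.
  move=> /eb/=; rewrite ltr_norml => /andP[_]; lra.
apply/negP; rewrite -leNgt; apply: cmax; rewrite in_itv/= s0/=.
by rewrite (le_trans (ltW sc)).
Qed.

(** The product [f t * expR (mu * t)] is nonincreasing. *)
Lemma exp_decay f df (mu : R) :
  (forall t, 0 <= t -> is_d f t (df t)) ->
  (forall t, 0 <= t -> df t <= - mu * f t) ->
  forall t, 0 <= t -> f t <= f 0 * expR (- mu * t).
Proof.
move=> H H0 t t0.
have dE (x : R) : is_d (fun y => expR (mu * y)) x (mu * expR (mu * x)).
  apply: is_d_eq (is_d_comp (is_dZ mu (is_d_id x)) (is_derive_expR _)) _.
  by rewrite mulr1 mulrC.
have : f t * expR (mu * t) <= f 0 * expR (mu * 0).
  apply: (@ge_of_is_d (fun y => f y * expR (mu * y))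
    (fun x => f x * (mu * expR (mu * x)) + expR (mu * x) * df x)) => //.
    by move=> x /andP[x0 _]; exact: is_dM (H x x0) (dE x).
  move=> x /andP[x0 _] /=.
  have -> : f x * (mu * expR (mu * x)) + expR (mu * x) * df x =
     expR (mu * x) * (mu * f x + df x) by ring.
  rewrite pmulr_rle0 ?expR_gt0//; have := H0 x x0; lra.
rewrite mulr0 expR0 mulr1 => K.
by rewrite mulNr expRN ler_pdivlMr ?expR_gt0.
Qed.

(** Let [h t] be the integral of the bound from [t] to infinity. Then [f - h] increases, [f + h]
    decreases, and the limit is trapped between them. *)
Lemma exp_convergence f df (C mu : R) : 0 < mu ->
  (forall t, 0 <= t -> is_d f t (df t)) ->
  (forall t, 0 <= t -> `|df t| <= C * expR (- mu * t)) ->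
  exists l, forall t, 0 <= t -> `|f t - l| <= C / mu * expR (- mu * t).
Proof.
move=> mu0 H H0.
have dE (x : R) : is_d (fun y => C / mu * expR (- mu * y)) x (- (C * expR (- mu * x))).
  apply: is_d_eq (is_dZ _ (is_d_comp (is_dZ (- mu) (is_d_id x)) (is_derive_expR _))) _.
  by field; rewrite gt_eqF.
pose h (y : R) := C / mu * expR (- mu * y).
have C0 : 0 <= C.
  by have := H0 0 (lexx _); rewrite mulr0 expR0 mulr1; exact: le_trans.
have h0 y : 0 <= h y by rewrite mulr_ge0 ?expR_ge0// divr_ge0// ltW.
have up s t : 0 <= s -> s <= t -> f s - h s <= f t - h t.
  move=> s0 st; apply: (@le_of_is_d (fun y => f y - h y)
    (fun x => df x - - (C * expR (- mu * x)))) => //.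
    by move=> x /andP[x0 _]; exact: is_dB (H x (le_trans s0 x0)) (dE x).
  move=> x /andP[sx _] /=; have := H0 x (le_trans s0 sx).
  by rewrite ler_norml => /andP[+ _]; lra.
have dn s t : 0 <= s -> s <= t -> f t + h t <= f s + h s.
  move=> s0 st; apply: (@ge_of_is_d (fun y => f y + h y)
    (fun x => df x + - (C * expR (- mu * x)))) => //.
    by move=> x /andP[x0 _]; exact: is_dD (H x (le_trans s0 x0)) (dE x).
  move=> x /andP[sx _] /=; have := H0 x (le_trans s0 sx).
  by rewrite ler_norml => /andP[_]; lra.
pose A := [set y | exists2 t, 0 <= t & y = f t - h t].
have Aub t : 0 <= t -> ubound A (f t + h t).
  move=> t0 _ [s s0 ->]; have [st|ts] := leP s t.
    by apply: le_trans (up s t s0 st) _; have := h0 t; lra.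
  by apply: le_trans (dn t s t0 (ltW ts)); have := h0 s; lra.
exists (sup A) => t t0; rewrite ler_distlC -/(h t); apply/andP; split.
  apply: ub_le_sup; first by exists (f t + h t); exact: Aub.
  by exists t.
by apply: ge_sup; [exists (f t - h t), t|exact: Aub].
Qed.

Lemma is_d_near f g x d : (exists2 e, 0 < e & forall y, `|y - x| < e -> f y = g y) ->
  is_d f x d -> is_d g x d.
Proof.
move=> [e e0 H]; apply: near_eq_is_derive.
by exists e => //= y /=; rewrite distrC => /H.
Qed.

Lemma primitive_right f : continuous f ->
  exists F, forall x, -1 < x -> is_d F x (f x).
Proof.
move=> cf.
exists (fun x => (\int[lebesgue_measure]_(t in [set` `[(-1 : R), x]]) (f t))%R).
move=> x x1; have xu : x < x + 1 by rewrite ltrDl.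
have [||] := @continuous_FTC1_closed R f (-1) x (x + 1) xu _ x1.
- apply: continuous_compact_integrable; first exact: segment_compact.
  exact: continuous_subspaceT.
- exact: cf.
by move=> D E; apply: DeriveDef; [exact: D|rewrite -derive1E; exact: E].
Qed.

(** An integral from -1 is a primitive to the right of -1, and its reflection gives one to the left
    of 1. On the overlap the two differ by a constant, so they can be glued at 0. *)
Lemma primitive f : continuous f -> exists F, forall x, is_d F x (f x).
Proof.
move=> cf; have [F HF] := primitive_right cf.
have cfN : continuous (fun x => f (- x)).
  move=> x; apply: (@continuous_comp _ _ _ (fun x => - x) f); last exact: cf.
  exact: opp_continuous.
have [H0 HH0] := primitive_right cfN.
pose H x := - H0 (- x).
have HH x : x < 1 -> is_d H x (f x).
  move=> x1; have xN : -1 < - x by rewrite ltrN2.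
  have := is_dN (is_d_comp (is_dN (is_d_id x)) (HH0 _ xN)).
  by rewrite opprK mulrN1 opprK.
have FH x y : -1 < x -> x <= y -> y < 1 -> F x - H x = F y - H y.
  move=> x1 xy y1; apply/eqP; rewrite eq_le; apply/andP.
  have D z : x <= z <= y -> is_d (fun z => F z - H z) z 0.
    move=> /andP[xz zy].
    have z1 : -1 < z by exact: lt_le_trans xz.
    have z2 : z < 1 by exact: le_lt_trans y1.
    by apply: is_d_eq (is_dB (HF z z1) (HH z z2)) _; rewrite subrr.
  split.
  - exact: (@le_of_is_d _ (fun=> 0) x y).
  - exact: (@ge_of_is_d _ (fun=> 0) x y).
have FH0 x : -1 < x -> x < 1 -> F x - F 0 = H x - H 0.
  move=> x1 x2; have [x0|/ltW x0] := leP x 0.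
    have := FH x 0 x1 x0 ltr01; lra.
  have := FH 0 x (ltrN10 _) x0 x2; lra.
exists (fun x => if 0 <= x then F x - F 0 else H x - H 0) => x.
have cst0 (z c d : R) (G : R -> R) : is_d G z d -> is_d (fun y => G y - c) z d.
  by move=> dG; apply: is_d_eq (is_dB dG (is_d_cst c z)) _; rewrite subr0.
have [x1|x1] := leP 1 x.
  apply: (@is_d_near (fun x => F x - F 0)); last first.
    by apply: cst0; apply: HF; lra.
  exists 1 => // y; rewrite ltr_norml => /andP[y1 _].
  by rewrite ifT//; lra.
apply: (@is_d_near (fun x => H x - H 0)); last first.
  by apply: cst0; apply: HH; lra.
exists (1 - x); first by rewrite subr_gt0.
move=> y; rewrite ltr_norml => /andP[_ y1].
by case: leP => // y0; rewrite FH0//; lra.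
Qed.

End Calculus.

(** * Global solutions of bounded Lipschitz systems *)

Section ODE.
Context {R : realType}.
Local Notation is_d f x d := (is_derive x (1 : R) f d).

Lemma lip_of_is_d (f df : R -> R) (K : R) :
  (forall x : R, is_d f x (df x)) -> (forall x, `|df x| <= K) ->
  forall s t : R, `|f s - f t| <= K * `|s - t|.
Proof.
move=> H H0.
have wl s t : s <= t -> `|f s - f t| <= K * `|s - t|.
  move=> st; rewrite distrC [`|s - t|]distrC [`|t - s|]ger0_norm ?subr_ge0//.
  rewrite ler_norml; apply/andP.
  have dK (c z : R) : is_d (fun y => c * y) z c.
    by apply: is_d_eq (is_dZ c (is_d_id z)) _; rewrite mulr1.
  split.
  - have := @le_of_is_d R (fun y => f y - (- K) * y) (fun x => df x - - K) s t st.
    have D z : s <= z <= t -> is_d (fun y => f y - - K * y) z (df z - - K).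
      by move=> _; exact: is_dB (H z) (dK _ _).
    move=> /(_ D) E; have : f s - - K * s <= f t - - K * t.
      by apply: E => x _; have := H0 x; rewrite ler_norml => /andP[]; lra.
    lra.
  - have := @ge_of_is_d R (fun y => f y - K * y) (fun x => df x - K) s t st.
    have D z : s <= z <= t -> is_d (fun y => f y - K * y) z (df z - K).
      by move=> _; exact: is_dB (H z) (dK _ _).
    move=> /(_ D) E; have : f t - K * t <= f s - K * s.
      by apply: E => x _; have := H0 x; rewrite ler_norml => /andP[]; lra.
    lra.
move=> s t; have [st|/ltW ts] := leP s t; first exact: wl.
by rewrite distrC [`|s - t|]distrC wl.
Qed.

Lemma norm_le_of_is_d (f df g dg : R -> R) : f 0 = 0 -> 0 <= g 0 ->
  (forall t : R, 0 <= t -> is_d f t (df t)) ->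
  (forall t : R, 0 <= t -> is_d g t (dg t)) ->
  (forall t : R, 0 <= t -> `|df t| <= dg t) ->
  forall t : R, 0 <= t -> `|f t| <= g t.
Proof.
move=> f0 g0 Hf Hg H t t0; rewrite ler_norml; apply/andP; split.
- have : f 0 + g 0 <= f t + g t.
    apply: (@le_of_is_d R (fun y => f y + g y) (fun y => df y + dg y)) => //.
      by move=> x /andP[x0 _]; exact: is_dD (Hf x x0) (Hg x x0).
    move=> x /andP[x0 _]; have := H x x0; rewrite ler_norml => /andP[]; lra.
  lra.
- have : g 0 - f 0 <= g t - f t.
    apply: (@le_of_is_d R (fun y => g y - f y) (fun y => dg y - df y)) => //.
      by move=> x /andP[x0 _]; exact: is_dB (Hg x x0) (Hf x x0).
    move=> x /andP[x0 _]; have := H x x0; rewrite ler_norml => /andP[]; lra.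
  lra.
Qed.

Lemma lip_continuous (f : R -> R) (K : R) :
  (forall s t : R, `|f s - f t| <= K * `|s - t|) -> continuous f.
Proof.
move=> H x; apply/cvgrPdist_lt => e e0.
have K0 : 0 <= K.
  by have := H 1 0; rewrite subr0 normr1 mulr1; exact: le_trans.
have K1 : 0 < K + 1 by rewrite ltr_wpDl.
exists (e / (K + 1)) => /=; first exact: divr_gt0.
move=> y /= xy; apply: le_lt_trans (H x y) _.
have : (K + 1) * `|x - y| < e by rewrite mulrC -ltr_pdivlMr.
by apply: le_lt_trans; rewrite ler_wpM2r// lerDl.
Qed.

Lemma le_of_geometric (x y c : R) :
  (forall n : nat, x <= y + c * 2^-1 ^+ n) -> x <= y.
Proof.
move=> H; rewrite leNgt; apply/negP => yx.
have c0 : 0 < c.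
  by have := H 0%N; rewrite expr0 mulr1; lra.
have xy0 : 0 < x - y by rewrite subr_gt0.
have := archi_boundP (ltW (divr_gt0 c0 xy0)).
set n := Num.bound _ => Hn.
have : c < (x - y) * 2 ^+ n.
  rewrite mulrC -ltr_pdivrMr//; apply: lt_le_trans Hn _.
  by rewrite -natrX ler_nat ltnW// ltn_expl.
rewrite -ltr_pdivrMr ?exprn_gt0// -exprVn; have := H n; lra.
Qed.

(** Discrete form of [exp_convergence]: here [h n] is the tail of the geometric series. *)
Lemma geometric_convergence (a : nat -> R) (c : R) :
  (forall n : nat, `|a n.+1 - a n| <= c * 2^-1 ^+ n) ->
  exists l : R, forall n : nat, `|a n - l| <= 2 * c * 2^-1 ^+ n.
Proof.
move=> H; pose h (n : nat) : R := 2 * c * 2^-1 ^+ n.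
have c0 : 0 <= c by have := H 0%N; rewrite expr0 mulr1; exact: le_trans.
have h0 n : 0 <= h n by rewrite /h !mulr_ge0// exprn_ge0// invr_ge0.
have hS n : h n.+1 = h n - c * 2^-1 ^+ n.
  by rewrite /h exprS; field.
have up m n : (m <= n)%N -> a m - h m <= a n - h n.
  elim: n => [|n IH]; first by rewrite leqn0 => /eqP ->.
  rewrite leq_eqVlt => /predU1P[-> //|]; rewrite ltnS => /IH.
  have := H n; rewrite ler_norml hS => /andP[]; lra.
have dn m n : (m <= n)%N -> a n + h n <= a m + h m.
  elim: n => [|n IH]; first by rewrite leqn0 => /eqP ->.
  rewrite leq_eqVlt => /predU1P[-> //|]; rewrite ltnS => /IH.
  have := H n; rewrite ler_norml hS => /andP[]; lra.
pose A := [set y | exists n, y = a n - h n].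
have Aub n : ubound A (a n + h n).
  move=> _ [m ->]; have [mn|/ltnW nm] := leqP m n.
    by apply: le_trans (up _ _ mn) _; have := h0 n; lra.
  by apply: le_trans (dn _ _ nm); have := h0 m; lra.
exists (sup A) => n; rewrite ler_distlC -/(h n); apply/andP; split.
  apply: ub_le_sup; first by exists (a n + h n); exact: Aub.
  by exists n.
by apply: ge_sup; [exists (a n - h n), n|exact: Aub].
Qed.

(** One constant serves both as a bound and as a Lipschitz constant for the sup distance, which is
    encoded by a bound [c] on all coordinates. Boundedness makes the class stable under products. *)
Definition bounded_lipschitz (I : Type) (f : (I -> R) -> R) :=
  exists2 C : R, 0 <= C & (forall x, `|f x| <= C) /\
    forall x y (c : R), 0 <= c -> (forall j, `|x j - y j| <= c) ->
      `|f x - f y| <= C * c.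

Lemma finite_bound (I : finType) (P : I -> R -> Prop) :
  (forall i a b, a <= b -> P i a -> P i b) ->
  (forall i, exists a, P i a) -> exists2 a : R, 0 < a & forall i, P i a.
Proof.
move=> Pm /choice[a aP].
exists (1 + \sum_i `|a i|); first by rewrite ltr_wpDr// sumr_ge0.
move=> i; apply: Pm (aP i); rewrite (bigD1 i)//= addrCA.
by rewrite (le_trans (ler_norm _))// lerDl addr_ge0// sumr_ge0.
Qed.

(* In the norm weighted by [expR (- 2 * K * t)], with K a Lipschitz constant, the
   Picard operator contracts by 1/2 on the whole half-line. *)
Lemma lipschitz_ode (I : finType) (F : I -> (I -> R) -> R) (u0 : I -> R) :
  (forall i, bounded_lipschitz (F i)) ->
  exists u : R -> I -> R, u 0 = u0 /\
    forall t : R, 0 <= t -> forall i, is_d (fun s => u s i) t (F i (u t)).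
Proof.
move=> FBL.
have [K K0 HK] : exists2 K : R, 0 < K & forall i, (forall x, `|F i x| <= K) /\
    forall x y (c : R), 0 <= c -> (forall j, `|x j - y j| <= c) ->
      `|F i x - F i y| <= K * c.
  apply: (@finite_bound I (fun i (K : R) => (forall x, `|F i x| <= K) /\
    forall x y (c : R), 0 <= c -> (forall j, `|x j - y j| <= c) ->
      `|F i x - F i y| <= K * c)).
    move=> i a b ab [H1 H2]; split=> [x|x y c c0 /(H2 x y c c0) H].
      exact: le_trans (H1 x) ab.
    by apply: le_trans H _; rewrite ler_wpM2r.
  by move=> i; have [C _ HC] := FBL i; exists C.
have FK i x : `|F i x| <= K by exact: (HK i).1.
have FL i x y (c : R) : 0 <= c -> (forall j, `|x j - y j| <= c) ->
    `|F i x - F i y| <= K * c by exact: (HK i).2.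
(* The choice of a primitive has to be total; discontinuous functions get an arbitrary value. *)
have /choice[Pr PrP] : forall f : R -> R, exists P : R -> R,
    continuous f -> P 0 = 0 /\ forall x, is_d P x (f x).
  move=> f.
  have [cf|ncf] := pselect (continuous f); last by exists f.
  have [P HP] := primitive cf; exists (fun x => P x - P 0) => _.
  split; first by rewrite subrr.
  by move=> x; apply: is_d_eq (is_dB (HP x) (is_d_cst (P 0) x)) _; rewrite subr0.
pose lipv (w : R -> I -> R) := forall i (s t : R), `|w s i - w t i| <= K * `|s - t|.
(* The Picard operator. Reading [w] at [|s|] gives an integrand on the whole line that depends only
   on the values of [w] at nonnegative times. *)
pose nx (w : R -> I -> R) := fun (t : R) i => u0 i + Pr (fun s : R => F i (w `|s|)) t.
have Fc w i : lipv w -> continuous (fun s : R => F i (w `|s|)).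
  move=> wl; apply: (@lip_continuous _ (K * K)) => s t.
  rewrite -mulrA; apply: FL; first by rewrite mulr_ge0// ltW.
  move=> j; apply: le_trans (wl j _ _) _.
  by rewrite ler_wpM2l ?(ltW K0)// ler_dist_dist.
have nx0 w : lipv w -> nx w 0 = u0.
  by move=> wl; apply/funext => i; rewrite /nx (PrP _ (Fc w i wl)).1 addr0.
have nxd w i (t : R) : lipv w -> is_d (fun s : R => nx w s i) t (F i (w `|t|)).
  move=> wl; have [_ /(_ t) D] := PrP _ (Fc w i wl).
  by apply: is_d_eq (is_dD (is_d_cst (u0 i) t) D) _; rewrite add0r.
have nxl w : lipv w -> lipv (nx w).
  move=> wl i; apply: (@lip_of_is_d _ (fun t : R => F i (w `|t|))) => // t.
  exact: nxd.
pose it n := iter n nx (fun=> u0).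
have itl n : lipv (it n).
  elim: n => [|n IH]; last exact: nxl.
  by move=> i s t; rewrite /it/= subrr normr0 mulr_ge0// ltW.
pose ex (t : R) := expR (2 * K * t).
have exd (c t : R) : is_d (fun s => c * ex s) t (K * (2 * c * ex t)).
  apply: is_d_eq (is_dZ c (is_d_comp (is_dZ (2 * K) (is_d_id t)) (is_derive_expR _))) _.
  by rewrite /ex; ring.
have ex0 (t : R) : 0 < ex t by exact: expR_gt0.
have ex1 (t : R) : 0 <= t -> 1 <= ex t.
  by move=> t0; rewrite -expR0 ler_expR !mulr_ge0// ltW.
(* The contraction: [c * ex] has derivative [K * (2 * c * ex)], which is exactly the Lipschitz bound
   for the difference of the integrands. *)
have nx_close w w' (c : R) : lipv w -> lipv w' -> 0 <= c ->
    (forall t : R, 0 <= t -> forall i, `|w t i - w' t i| <= 2 * c * ex t) ->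
    forall t : R, 0 <= t -> forall i, `|nx w t i - nx w' t i| <= c * ex t.
  move=> wl wl' c0 ww' t t0 i.
  apply: (@norm_le_of_is_d (fun t => nx w t i - nx w' t i)
    (fun t => F i (w `|t|) - F i (w' `|t|)) (fun t => c * ex t)
    (fun t => K * (2 * c * ex t))) => //.
  - by rewrite !nx0// subrr.
  - by rewrite mulr_ge0// ltW.
  - by move=> s s0; exact: is_dB (nxd _ _ _ _) (nxd _ _ _ _).
  - move=> s s0; rewrite (ger0_norm s0); apply: FL; last by move=> j; exact: ww'.
    by rewrite !mulr_ge0// ltW.
have geo0 n : 0 <= (2^-1 : R) ^+ n by rewrite exprn_ge0// invr_ge0.
have itd n (t : R) : 0 <= t -> forall i, `|it n.+1 t i - it n t i| <= 2^-1 ^+ n * ex t.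
  elim: n t => [|n IH] t t0 i.
    rewrite expr0 /it/=.
    apply: (@norm_le_of_is_d (fun t => nx (fun=> u0) t i - u0 i)
      (fun t => F i u0) (fun t => 1 * ex t) (fun t => K * (2 * 1 * ex t))) => //.
    - by rewrite nx0 ?subrr//; exact: (itl 0%N).
    - by rewrite mul1r ltW.
    - move=> s _; apply: is_d_eq (is_dB (nxd _ i s (itl 0%N)) (is_d_cst (u0 i) s)) _.
      by rewrite subr0.
    - move=> s s0; apply: le_trans (FK _ _) _; rewrite ler_peMr ?(ltW K0)//.
      by have := ex1 s s0; lra.
  apply: (nx_close (it n.+1) (it n) (2^-1 ^+ n.+1)) => // s s0 j.
  apply: le_trans (IH s s0 j) _; rewrite exprS ler_wpM2r ?(ltW (ex0 _))//; lra.
have [u uP] : exists u : R -> I -> R, forall t : R, 0 <= t -> forall i n,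
    `|it n t i - u t i| <= 2 * ex t * 2^-1 ^+ n.
  have : forall ti : R * I, exists l : R, 0 <= ti.1 -> forall n : nat,
      `|it n ti.1 ti.2 - l| <= 2 * ex ti.1 * 2^-1 ^+ n.
    move=> [t i]/=; have [t0|t0] := leP 0 t; last by exists 0.
    have [|l lP] := @geometric_convergence (fun n => it n t i) (ex t).
      by move=> n; rewrite mulrC; exact: itd.
    by exists l.
  by move=> /choice[u uP]; exists (fun t i => u (t, i)) => t t0 i; exact: (uP (t, i)).
pose w (t : R) := u `|t|.
have w_lip : lipv w.
  move=> i s t; have [s0 t0] := (normr_ge0 s, normr_ge0 t).
  apply: (@le_trans _ _ (K * `| `|s| - `|t| |)); last first.
    by rewrite ler_wpM2l ?(ltW K0)// ler_dist_dist.
  apply: (@le_of_geometric _ _ (2 * ex `|s| + 2 * ex `|t|)) => n.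
  have := uP _ s0 i n; have := uP _ t0 i n; have := itl n i `|s| `|t|.
  rewrite /w !ler_norml => /andP[? ?] /andP[? ?] /andP[? ?]; apply/andP; split; lra.
(* A pointwise limit need not be differentiable, but its image under the Picard operator is; [vu]
   shows that the two agree for nonnegative times. *)
pose v := nx w.
have vu (t : R) : 0 <= t -> v t = u t.
  move=> t0; apply/funext => i; apply/eqP; rewrite -subr_eq0 -normr_le0.
  apply: (@le_of_geometric _ _ (2 * ex t)) => n; rewrite add0r.
  have : `|nx w t i - nx (it n) t i| <= 2^-1 ^+ n * ex t.
    apply: (nx_close w (it n)) => // s s0 j; rewrite (_ : w s = u s) 1?distrC; last by rewrite /w ger0_norm.
    by have := uP s s0 j n; lra.
  have := uP t t0 i n.+1; rewrite -[it n.+1]/(nx (it n)) -/v exprS.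
  rewrite !ler_norml => /andP[? ?] /andP[? ?]; apply/andP; split; lra.
exists v; split; first exact: nx0.
move=> t t0 i; apply: is_d_eq (nxd _ _ _ w_lip) _.
by rewrite /w !ger0_norm// vu.
Qed.

End ODE.

(** * The angle function *)

Ltac nneg := repeat first
  [ done | exact: expR_ge0 | exact: sqr_ge0 | by apply: ltW
  | apply: divr_ge0 | apply: mulr_ge0 | apply: addr_ge0 ].

Section AngleFunction.
Context {R : realType}.
Local Notation is_d f x d := (is_derive x (1 : R) f d).

Lemma is_dV (f : R -> R) (x a : R) : is_d f x a -> f x != 0 ->
  is_d (fun y => (f y)^-1) x (- a / f x ^+ 2).
Proof.
move=> D fx0; apply: is_d_eq (is_deriveV fx0 D) _.
by rewrite [LHS]mulrC mulrN mulNr.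
Qed.

Lemma is_d_sqr (f : R -> R) (x a : R) : is_d f x a ->
  is_d (fun y => f y ^+ 2) x (2 * f x * a).
Proof. by move=> D; apply: is_d_eq (is_dM D D) _; ring. Qed.

(* [gang t s] is [atan (t * tanh (s / 2))]. *)
Definition gang (t s : R) : R := atan (t * ((expR s - 1) / (expR s + 1))).

Definition dgang (t s : R) : R :=
  2 * t * expR s / ((expR s + 1) ^+ 2 + t ^+ 2 * (expR s - 1) ^+ 2).

Lemma expRD1_gt0 (s : R) : 0 < expR s + 1.
Proof. by rewrite addr_gt0// expR_gt0. Qed.

Lemma dgang_den_gt0 (t s : R) :
  0 < (expR s + 1) ^+ 2 + t ^+ 2 * (expR s - 1) ^+ 2.
Proof.
by rewrite ltr_wpDr// ?exprn_gt0 ?expRD1_gt0// mulr_ge0// sqr_ge0.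
Qed.

Lemma is_d_gang (t s : R) : is_d (gang t) s (dgang t s).
Proof.
have E1 : expR s + 1 != 0 by rewrite gt_eqF// expRD1_gt0.
have D1 : is_d (fun y => expR y - 1) s (expR s - 0).
  exact: is_dB (is_derive_expR s) (is_d_cst 1 s).
have D2 : is_d (fun y => expR y + 1) s (expR s + 0).
  exact: is_dD (is_derive_expR s) (is_d_cst 1 s).
have D3 := is_dZ t (is_dM D1 (is_dV D2 E1)).
have D4 := is_d_comp D3 (is_derive1_atan _).
apply: is_d_eq D4 _.
rewrite /dgang; field.
by rewrite E1 exprMn gt_eqF ?dgang_den_gt0.
Qed.

Lemma gangN (t s : R) : gang t (- s) = - gang t s.
Proof.
rewrite /gang -atanN expRN; congr atan.
have E0 := expR_gt0 s; have E1 := expRD1_gt0 s.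
by field; rewrite !gt_eqF//= addrC.
Qed.

Lemma dgangN (t s : R) : dgang t (- s) = dgang t s.
Proof.
rewrite /dgang expRN; have E0 := expR_gt0 s; have H := dgang_den_gt0 t s.
have -> : (expR s)^-1 + 1 = (expR s + 1) / expR s by field; rewrite gt_eqF.
have -> : (expR s)^-1 - 1 = - (expR s - 1) / expR s by field; rewrite gt_eqF.
by field; rewrite (gt_eqF E0) exprMn (gt_eqF H).
Qed.

Lemma dgang_gt0 (t s : R) : 0 < t -> 0 < dgang t s.
Proof.
by move=> t0; rewrite divr_gt0 ?dgang_den_gt0// !mulr_gt0 ?expR_gt0.
Qed.

Lemma gang_bound (t s : R) : 0 < t -> `|gang t s| <= atan t.
Proof.
move=> t0; have E1 := expRD1_gt0 s; have E0 := expR_gt0 s.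
rewrite ler_norml -atanN; apply/andP; split; apply: le_atan.
- by rewrite -[leLHS]mulrN1 ler_pM2l// ler_pdivlMr//; lra.
- by rewrite -[leRHS]mulr1 ler_pM2l// ler_pdivrMr//; lra.
Qed.

(* The denominator of [dgang] dominates a multiple of [e^(2s) + 1]. *)
Definition dgang_min (t : R) : R := Num.min 1 (t ^+ 2).

Lemma dgang_min_gt0 (t : R) : 0 < t -> 0 < dgang_min t.
Proof. by move=> t0; rewrite lt_min ltr01 exprn_gt0. Qed.

(** Both weights 1 and [t ^+ 2] are at least [dgang_min t], and the two squares add up to
    [2 * (X ^+ 2 + 1)]. *)
Lemma dgang_den_ge (t X : R) : 0 < t ->
  2 * dgang_min t * (X ^+ 2 + 1) <= (X + 1) ^+ 2 + t ^+ 2 * (X - 1) ^+ 2.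
Proof.
move=> t0; have m1 : dgang_min t <= 1 by rewrite ge_min lexx.
have m2 : dgang_min t <= t ^+ 2 by rewrite ge_min lexx orbT.
have := sqr_ge0 (X - 1); have := sqr_ge0 (X + 1).
move: m1 m2; set m := dgang_min t => m1 m2 h1 h2.
have := ler_wpM2r h1 m1; have := ler_wpM2r h2 m2; lra.
Qed.

Lemma dgang_le (t s : R) : 0 < t -> dgang t s <= t / (2 * dgang_min t).
Proof.
move=> t0; have m0 := dgang_min_gt0 t0.
rewrite /dgang ler_pdivrMr ?dgang_den_gt0//.
apply: le_trans (ler_wpM2l _ (dgang_den_ge (expR s) t0)); last first.
  by rewrite divr_ge0// ?ltW// mulr_gt0.
have -> : t / (2 * dgang_min t) * (2 * dgang_min t * (expR s ^+ 2 + 1)) =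
    t * (expR s ^+ 2 + 1) by field; rewrite gt_eqF.
rewrite [2 * t]mulrC -mulrA ler_pM2l//.
have := sqr_ge0 (expR s - 1); lra.
Qed.

Lemma dgang_ge (t B : R) : 0 < t ->
  exists2 w, 0 < w & forall s : R, `|s| <= B -> w <= dgang t s.
Proof.
(* The least numerator over an upper bound for the denominator; [expR B + 1] also dominates
   [|expR s - 1|]. *)
move=> t0; exists (2 * t * expR (- B) / ((expR B + 1) ^+ 2 + t ^+ 2 * (expR B + 1) ^+ 2)).
  rewrite divr_gt0//; first by rewrite !mulr_gt0// expR_gt0.
  by rewrite ltr_wpDr// ?exprn_gt0 ?expRD1_gt0// mulr_ge0// sqr_ge0.
move=> s; rewrite ler_norml => /andP[Bs sB].
have EB : expR s <= expR B by rewrite ler_expR.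
have EB' : expR (- B) <= expR s by rewrite ler_expR.
have E0 := expR_gt0 s.
rewrite /dgang ler_pM//.
- by rewrite !mulr_ge0 ?(ltW t0)// expR_ge0.
- by rewrite invr_ge0 addr_ge0 ?sqr_ge0// mulr_ge0// sqr_ge0.
- by rewrite ler_pM2l// mulr_gt0.
- rewrite lef_pV2 ?posrE ?dgang_den_gt0//; last first.
    by rewrite ltr_wpDr// ?exprn_gt0 ?expRD1_gt0// mulr_ge0// sqr_ge0.
  apply: lerD; first by rewrite ler_sqr ?nnegrE; lra.
  by rewrite ler_wpM2l ?sqr_ge0// -subr_ge0 subr_sqr mulr_ge0//; lra.
Qed.

Lemma gang_lip (t : R) : 0 < t ->
  exists2 C, 0 <= C & forall x y : R, `|gang t x - gang t y| <= C * `|x - y|.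
Proof.
move=> t0; exists (t / (2 * dgang_min t)).
  by rewrite divr_ge0 ?(ltW t0)// mulr_ge0// ltW// dgang_min_gt0.
apply: lip_of_is_d (is_d_gang t) _ => x.
by rewrite gtr0_norm ?dgang_gt0// dgang_le.
Qed.

Lemma dgang_lip (t : R) : 0 < t ->
  exists2 C, 0 <= C & forall x y : R, `|dgang t x - dgang t y| <= C * `|x - y|.
Proof.
move=> t0; pose m := dgang_min t; have m0 : 0 < m by exact: dgang_min_gt0.
exists (t * (1 + t ^+ 2) / (2 * m ^+ 2)).
  by nneg.
pose den (X : R) : R := (X + 1) ^+ 2 + t ^+ 2 * (X - 1) ^+ 2.
(* The derivative of [dgang t]. With [X = expR s] it is bounded because
   [X * |1 - X^2| <= (X^2 + 1)^2] while [den X >= 2 * m * (X^2 + 1)]. *)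
pose dd (s : R) := 2 * t * expR s * (1 + t ^+ 2) * (1 - expR s ^+ 2) / den (expR s) ^+ 2.
have den0 s : 0 < den (expR s) by exact: dgang_den_gt0.
apply: (@lip_of_is_d _ (dgang t) dd) => s.
  have D1 : is_d (fun y => expR y - 1) s (expR s - 0).
    exact: is_dB (is_derive_expR s) (is_d_cst 1 s).
  have D2 : is_d (fun y => expR y + 1) s (expR s + 0).
    exact: is_dD (is_derive_expR s) (is_d_cst 1 s).
  have D3 := is_dD (is_d_sqr D2) (is_dZ (t ^+ 2) (is_d_sqr D1)).
  have den1 : den (expR s) != 0 by rewrite gt_eqF.
  have D4 := is_dM (is_dZ (2 * t) (is_derive_expR s)) (is_dV D3 den1).
  apply: is_d_eq D4 _.
  by rewrite /dd /den; field; rewrite exprMn.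
have E0 := expR_gt0 s; set E := expR s in E0 *.
have dE := dgang_den_ge E t0; rewrite -/m -/(den E) in dE.
rewrite /dd normrM normfV (ger0_norm (sqr_ge0 _)) -/E.
rewrite ler_pdivrMr ?exprn_gt0 ?den0//.
have K1 : (2 * m * (E ^+ 2 + 1)) ^+ 2 <= den E ^+ 2.
  by rewrite ler_sqr ?nnegrE ?(ltW (den0 s))//; nneg.
apply: le_trans (ler_wpM2l _ K1); last first.
  by nneg.
rewrite normrM [`|2 * _ * _ * _|]ger0_norm; last first.
  by nneg.
have -> : t * (1 + t ^+ 2) / (2 * m ^+ 2) * (2 * m * (E ^+ 2 + 1)) ^+ 2 =
   2 * t * (1 + t ^+ 2) * (E ^+ 2 + 1) ^+ 2 by field; rewrite gt_eqF.
have -> : 2 * t * E * (1 + t ^+ 2) * `|1 - E ^+ 2| =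
   2 * t * (1 + t ^+ 2) * (E * `|1 - E ^+ 2|) by ring.
apply: ler_wpM2l; first by nneg.
rewrite expr2 ler_pM ?(ltW E0)//.
  by have := sqr_ge0 (E - 1); have := sqr_ge0 E; lra.
by rewrite ler_norml; have := sqr_ge0 E => ?; apply/andP; split; lra.
Qed.

(** Uniformity in [y] is the point: both values decay as [|y|] grows, so their difference is
    measured against their sum. With denominators [D1] and [D2], the ratio is
    [(D2 - D1) / (D1 + D2)], and [D2 - D1] contains the factor [X^2 - 1], small with [x]. *)
Lemma dgang_diff_sum (t : R) : 0 < t ->
  exists2 C, 0 <= C & forall x y : R, x <= 0 ->
    `|dgang t (x + y) - dgang t (x - y)| <=
    C * `|x| * (dgang t (x + y) + dgang t (x - y)).
Proof.
move=> t0; pose m := dgang_min t; have m0 : 0 < m by exact: dgang_min_gt0.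
exists (2 * (1 + t ^+ 2) / m); first by nneg.
move=> x y x0; pose X := expR x; pose Y := expR y.
have X0 : 0 < X by exact: expR_gt0. have Y0 : 0 < Y by exact: expR_gt0.
pose D1 := (X * Y + 1) ^+ 2 + t ^+ 2 * (X * Y - 1) ^+ 2.
pose D2 := (X + Y) ^+ 2 + t ^+ 2 * (X - Y) ^+ 2.
have D10 : 0 < D1.
  by rewrite ltr_wpDr ?exprn_gt0 ?addr_gt0 ?mulr_gt0// mulr_ge0// sqr_ge0.
have D20 : 0 < D2.
  by rewrite ltr_wpDr ?exprn_gt0 ?addr_gt0// mulr_ge0// sqr_ge0.
have -> : dgang t (x + y) = 2 * t * X * Y / D1.
  by rewrite /dgang expRD -/X -/Y mulrA.
have -> : dgang t (x - y) = 2 * t * X * Y / D2.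
  rewrite /dgang expRD expRN -/X -/Y.
  have -> : X / Y + 1 = (X + Y) / Y by field; rewrite gt_eqF.
  have -> : X / Y - 1 = (X - Y) / Y by field; rewrite gt_eqF.
  by rewrite /D2; field; rewrite exprMn (gt_eqF D20) (gt_eqF Y0).
have -> : 2 * t * X * Y / D1 - 2 * t * X * Y / D2 =
  2 * t * X * Y / (D1 * D2) * ((1 + t ^+ 2) * ((X ^+ 2 - 1) * (1 - Y ^+ 2))).
  by rewrite /D1 /D2; field; rewrite !exprMn (gt_eqF D20) (gt_eqF D10).
have -> : 2 * t * X * Y / D1 + 2 * t * X * Y / D2 =
  2 * t * X * Y / (D1 * D2) * (D1 + D2).
  by field; rewrite !gt_eqF.
have P0 : 0 < 2 * t * X * Y / (D1 * D2) by rewrite divr_gt0 ?mulr_gt0.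
rewrite normrM (gtr0_norm P0) [leRHS]mulrCA ler_pM2l//.
have S1 : D1 + D2 = (X * Y + 1) ^+ 2 + (X + Y) ^+ 2 +
   t ^+ 2 * ((X * Y - 1) ^+ 2 + (X - Y) ^+ 2) by rewrite /D1 /D2; ring.
have S : m * ((X ^+ 2 + 1) * (Y ^+ 2 + 1)) <= D1 + D2.
  rewrite S1; have m1 : m <= 1 by rewrite ge_min lexx.
  have m2 : m <= t ^+ 2 by rewrite ge_min lexx orbT.
  have h1 : 0 <= (X * Y + 1) ^+ 2 + (X + Y) ^+ 2 by rewrite addr_ge0 ?sqr_ge0.
  have h2 : 0 <= (X * Y - 1) ^+ 2 + (X - Y) ^+ 2 by rewrite addr_ge0 ?sqr_ge0.
  have := ler_wpM2r h1 m1; have := ler_wpM2r h2 m2.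
  have : 0 <= m * ((X ^+ 2 + 1) * (Y ^+ 2 + 1)).
    by nneg.
  lra.
have X1 : X <= 1 by rewrite /X -expR0 ler_expR.
have XX : 1 - X <= `|x|.
  by rewrite ler0_norm//; have := expR_ge1Dx x; rewrite -/X; lra.
apply: (@le_trans _ _ (2 * (1 + t ^+ 2) / m * `|x| * (m * ((X ^+ 2 + 1) * (Y ^+ 2 + 1))))); last first.
  by apply: ler_wpM2l => //; nneg.
have -> : 2 * (1 + t ^+ 2) / m * `|x| * (m * ((X ^+ 2 + 1) * (Y ^+ 2 + 1))) =
  (1 + t ^+ 2) * (2 * `|x| * (X ^+ 2 + 1) * (Y ^+ 2 + 1)) by field; rewrite gt_eqF.
rewrite normrM (@ger0_norm _ (1 + t ^+ 2)) ?addr_ge0 ?sqr_ge0// ler_wpM2l ?addr_ge0 ?sqr_ge0//.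
rewrite normrM ler_pM//; last first.
  by rewrite ler_norml; have := sqr_ge0 Y => ?; apply/andP; split; lra.
rewrite ler0_norm; last by rewrite subr_le0 expr_le1// ltW.
have -> : - (X ^+ 2 - 1) = (1 - X) * (1 + X) by ring.
have := ler_pM (_ : 0 <= 1 - X) (_ : 0 <= 1 + X) XX (_ : 1 + X <= 2 * (X ^+ 2 + 1)).
rewrite mulrA [`|x| * 2]mulrC; apply; [lra|lra|have := sqr_ge0 X; lra].
Qed.

Lemma atan_lip (x y : R) : `|atan x - atan y| <= `|x - y|.
Proof.
rewrite -[leRHS]mul1r; apply: (lip_of_is_d (@is_derive1_atan R)) => z.
by rewrite ger0_norm ?invr_ge0 ?addr_ge0 ?sqr_ge0// invf_le1 ?ltr_wpDr ?sqr_ge0// lerDl sqr_ge0.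
Qed.

(** The gap to the limit at infinity is integrable, so a primitive of [gang t] stays above
    [atan t * |s|] up to a constant. *)
Lemma gang_gap (t s : R) : 0 < t -> atan t - gang t s <= 2 * t * expR (- s).
Proof.
move=> t0; have E0 := expR_gt0 s; have E1 := expRD1_gt0 s.
apply: le_trans (ler_norm _) _; apply: le_trans (atan_lip _ _) _.
have -> : t - t * ((expR s - 1) / (expR s + 1)) = 2 * t * (expR s + 1)^-1.
  by field; rewrite gt_eqF.
rewrite ger0_norm; last by rewrite mulr_ge0 ?invr_ge0 ?mulr_ge0 ?(ltW t0) ?(ltW E1).
rewrite ler_pM2l ?mulr_gt0// expRN lef_pV2 ?posrE//; lra.
Qed.

Lemma gang_primitive (t : R) : 0 < t -> exists G : R -> R,
  (forall s : R, is_d G s (gang t s)) /\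
  exists C, forall s, atan t * `|s| - C <= G s.
Proof.
move=> t0; have cg : continuous (gang t).
  by move=> s; exact: is_d_continuous (is_d_gang t s).
have [G HG] := primitive cg; exists G; split=> //.
(* Here [2 * t] is the integral of the bound in [gang_gap] over the half-line. *)
exists (2 * t - G 0) => s.
have dK (c z : R) : is_d (fun y => c * y) z c.
  by apply: is_d_eq (is_dZ c (is_d_id z)) _; rewrite mulr1.
have dE (c z : R) : is_d (fun y => 2 * t * expR (c * y)) z (2 * t * (expR (c * z) * c)).
  exact: is_dZ (is_d_comp (dK c z) (is_derive_expR _)).
have [s0|/ltW s0] := leP 0 s.
  rewrite ger0_norm//.
  have : G 0 - atan t * 0 - 2 * t * expR (-1 * 0) <=
      G s - atan t * s - 2 * t * expR (-1 * s).
    have D x : is_d (fun y => G y - atan t * y - 2 * t * expR (-1 * y)) x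
        (gang t x - atan t - 2 * t * (expR (-1 * x) * -1)).
      exact: is_dB (is_dB (HG x) (dK _ x)) (dE _ x).
    apply: (le_of_is_d s0 (fun x _ => D x)) => x _; have := gang_gap x t0; rewrite mulN1r; lra.
  rewrite !mulr0 expR0; have := expR_gt0 (-1 * s).
  by move=> /(mulr_gt0 (mulr_gt0 (ltr0n R 2) t0)); lra.
rewrite ler0_norm//.
have : G 0 + atan t * 0 - 2 * t * expR (1 * 0) <=
    G s + atan t * s - 2 * t * expR (1 * s).
  have D x : is_d (fun y => G y + atan t * y - 2 * t * expR (1 * y)) x
      (gang t x + atan t - 2 * t * (expR (1 * x) * 1)).
    exact: is_dB (is_dD (HG x) (dK _ x)) (dE _ x).
  apply: (ge_of_is_d s0 (fun x _ => D x)) => x _; have := gang_gap (- x) t0; rewrite mul1r opprK gangN; lra.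
rewrite !mulr0 expR0; have := expR_gt0 (1 * s).
by move=> /(mulr_gt0 (mulr_gt0 (ltr0n R 2) t0)); lra.
Qed.

End AngleFunction.

(** * Inner angles in half-angle form *)

Section Geometry.
Context {R : realType}.

Definition ucoord (bg : background) (r : R) : R :=
  match bg with
  | Hyperbolic => ln ((expR r - 1) / (expR r + 1))
  | Euclidean => ln r
  end.

Definition radius (bg : background) (u : R) : R :=
  match bg with
  | Hyperbolic => ln ((1 + expR u) / (1 - expR u))
  | Euclidean => expR u
  end.

(** The part of the angle governed by u_i + u_j. The Euclidean constant is the limit of [gang t s]
    as [s] tends to minus infinity, in accordance with small hyperbolic triangles being nearly
    Euclidean; one formula [- sgang - gang] then covers both geometries. *)
Definition sgang (bg : background) (t s : R) : R :=
  match bg with Hyperbolic => gang t s | Euclidean => - atan t end.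

Definition dsgang (bg : background) (t s : R) : R :=
  match bg with Hyperbolic => dgang t s | Euclidean => 0 end.

(** The argument is the cosine of the sum of the two arctangents; the sign condition places that sum
    in the range of [acos]. *)
Lemma acos_atanD (A B : R) : 0 <= A + B ->
  acos ((1 - A * B) / (Num.sqrt (1 + A ^+ 2) * Num.sqrt (1 + B ^+ 2))) =
  atan A + atan B.
Proof.
move=> AB; rewrite -[RHS]cosK; last first.
  rewrite in_itv/=; apply/andP; split.
    rewrite -[atan B]opprK -atanN subr_ge0 le_atan//; lra.
  by have := atan_ltpi2 A; have := atan_ltpi2 B; lra.
have sin_atan x : sin (atan x) = x * cos (atan x).
  have c0 : cos (atan x) != 0.
    by rewrite cos_atan invr_eq0 sqrtr_eq0 -ltNge ltr_wpDr// sqr_ge0.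
  by rewrite -{2}[x]atanK /tan divfK.
congr acos; rewrite cosD !sin_atan !cos_atan invfM; ring.
Qed.

Lemma cos_half_tan (th : R) : 0 < th < pi ->
  cos th = (1 - tan (th / 2) ^+ 2) / (1 + tan (th / 2) ^+ 2).
Proof.
move=> /andP[th0 thpi].
have c0 : 0 < cos (th / 2) by apply: cos_gt0_pihalf; have := pi_gt0 R; lra.
have c1 : cos (th / 2) != 0 by rewrite gt_eqF.
rewrite -cos2_tan2// /tan.
rewrite {1}(splitr th) cosD; field.
by rewrite c1.
Qed.

Lemma tan_half_gt0 (th : R) : 0 < th < pi -> 0 < tan (th / 2).
Proof.
move=> /andP[th0 thpi]; rewrite /tan divr_gt0//.
  by apply: sin_gt0_pi; have := pi_gt0 R; lra.
by apply: cos_gt0_pihalf; have := pi_gt0 R; lra.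
Qed.

Lemma atan_tan_half (th : R) : 0 < th < pi -> atan (tan (th / 2)) = th / 2.
Proof.
by move=> /andP[th0 thpi]; rewrite tanK// in_itv/=; apply/andP; split; lra.
Qed.

Lemma sinh_gt0 (a : R) : 0 < a -> 0 < sinh a.
Proof. by move=> a0; rewrite divr_gt0// subr_gt0 ltr_expR; lra. Qed.

Lemma sinh_arcosh (x : R) : 1 <= x -> sinh (arcosh x) = Num.sqrt (x ^+ 2 - 1).
Proof.
move=> x1; have H := arcoshK x1.
have -> : x ^+ 2 - 1 = sinh (arcosh x) ^+ 2.
  rewrite -[in LHS]H /cosh /sinh expRN; have := expR_gt0 (arcosh x).
  by move=> E0; field; rewrite gt_eqF.
rewrite sqrtr_sqr ger0_norm// /sinh divr_ge0// subr_ge0 ler_expR.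
by have := arcosh_ge0 x1; lra.
Qed.

(* [thalf a] is [tanh (a / 2)], the exponential of [ucoord Hyperbolic a]. *)
Definition thalf (a : R) : R := (expR a - 1) / (expR a + 1).

Lemma thalf_itv (a : R) : 0 < a -> 0 < thalf a < 1.
Proof.
move=> a0; have E1 := expRD1_gt0 a.
have E2 : 1 < expR a by rewrite -expR0 ltr_expR.
by rewrite divr_gt0 ?subr_gt0//= ltr_pdivrMr//; lra.
Qed.

Lemma cosh_thalf (a : R) : 0 < a ->
  cosh a = (1 + thalf a ^+ 2) / (1 - thalf a ^+ 2).
Proof.
move=> a0; have E0 := expR_gt0 a; have E1 := expRD1_gt0 a.
have E2 : 1 < expR a by rewrite -expR0 ltr_expR.
rewrite /cosh /thalf expRN; field; rewrite !gt_eqF//=.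
by rewrite subr_gt0 ltr_sqr ?nnegrE; lra.
Qed.

Lemma sinh_thalf (a : R) : 0 < a ->
  sinh a = 2 * thalf a / (1 - thalf a ^+ 2).
Proof.
move=> a0; have E0 := expR_gt0 a; have E1 := expRD1_gt0 a.
have E2 : 1 < expR a by rewrite -expR0 ltr_expR.
rewrite /sinh /thalf expRN; field; rewrite !gt_eqF//=.
by rewrite subr_gt0 ltr_sqr ?nnegrE; lra.
Qed.

Lemma hyperbolic_angle (th a b : R) : 0 < th < pi -> 0 < a -> 0 < b ->
  inner_angle Hyperbolic (edge_length Hyperbolic th a b) a b =
  - gang (tan (th / 2)) (ucoord Hyperbolic a + ucoord Hyperbolic b)
  - gang (tan (th / 2)) (ucoord Hyperbolic a - ucoord Hyperbolic b).
Proof.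
move=> th0 a0 b0; rewrite /inner_angle /edge_length cos_half_tan//.
have := tan_half_gt0 th0; set t := tan _; clearbody t => t0.
rewrite !(cosh_thalf a0) !(cosh_thalf b0) !(sinh_thalf a0) !(sinh_thalf b0) /ucoord -/(thalf a) -/(thalf b).
have := thalf_itv a0; have := thalf_itv b0.
set x := thalf a; set y := thalf b; clearbody x y => /andP[y0 y1] /andP[x0 x1].
have x2 : 0 < 1 - x ^+ 2 by rewrite subr_gt0 expr_lt1// ltW.
have y2 : 0 < 1 - y ^+ 2 by rewrite subr_gt0 expr_lt1// ltW.
have t2 : 0 < 1 + t ^+ 2 by rewrite ltr_wpDr// sqr_ge0.
have xy0 : 0 < x + y by rewrite addr_gt0.
have xy1 : x * y < 1 by rewrite mulr_ilt1// ltW.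
have xy2 : 0 < 1 + x * y by rewrite addr_gt0// mulr_gt0.
pose X := (1 + x ^+ 2) / (1 - x ^+ 2) * ((1 + y ^+ 2) / (1 - y ^+ 2)) +
  2 * x / (1 - x ^+ 2) * (2 * y / (1 - y ^+ 2)) * ((1 - t ^+ 2) / (1 + t ^+ 2)).
rewrite -/X.
(* Napier's analogies: [A] and [B] are the tangents of the half-sum and the half-difference of the
   angles at the two centers. The third angle is pi - Theta, whose half has cotangent [t]. *)
pose A := t * ((1 - x * y) / (1 + x * y)); pose B := t * ((y - x) / (x + y)).
(* [X] is the cosh of the edge length. Factoring [X - 1] and [X + 1] splits its sinh, the root of
   their product, into the two roots of [acos_atanD]. *)
have XB : X - 1 = 2 * (x + y) ^+ 2 * (1 + B ^+ 2) /
   ((1 + t ^+ 2) * (1 - x ^+ 2) * (1 - y ^+ 2)).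
  by rewrite /X /B; field; rewrite !gt_eqF.
have XA : X + 1 = 2 * (1 + x * y) ^+ 2 * (1 + A ^+ 2) /
   ((1 + t ^+ 2) * (1 - x ^+ 2) * (1 - y ^+ 2)).
  by rewrite /X /A; field; rewrite !gt_eqF.
pose Z := 2 * (1 + x * y) * (x + y) / ((1 + t ^+ 2) * (1 - x ^+ 2) * (1 - y ^+ 2)).
have Z0 : 0 < Z by rewrite divr_gt0 ?mulr_gt0.
have A2 : 0 < 1 + A ^+ 2 by rewrite ltr_wpDr// sqr_ge0.
have B2 : 0 < 1 + B ^+ 2 by rewrite ltr_wpDr// sqr_ge0.
have X1 : 1 <= X.
  by rewrite -subr_ge0 XB divr_ge0// ltW// !mulr_gt0// exprn_gt0.
rewrite arcoshK// sinh_arcosh//.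
pose sA := Num.sqrt (1 + A ^+ 2); pose sB := Num.sqrt (1 + B ^+ 2).
have sA0 : 0 < sA by rewrite sqrtr_gt0.
have sB0 : 0 < sB by rewrite sqrtr_gt0.
have sA2 : sA ^+ 2 = 1 + A ^+ 2 by rewrite sqr_sqrtr// ltW.
have sB2 : sB ^+ 2 = 1 + B ^+ 2 by rewrite sqr_sqrtr// ltW.
have -> : X ^+ 2 - 1 = (Z * (sA * sB)) ^+ 2.
  rewrite !exprMn sA2 sB2.
  have -> : X ^+ 2 - 1 = (X - 1) * (X + 1) by ring.
  by rewrite XA XB /Z; field; rewrite !gt_eqF.
rewrite sqrtr_sqr (gtr0_norm (mulr_gt0 Z0 (mulr_gt0 sA0 sB0))).
have AB : 0 <= A + B.
  rewrite /A /B -mulrDr mulr_ge0 ?(ltW t0)//.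
  have -> : (1 - x * y) / (1 + x * y) + (y - x) / (x + y) =
    2 * y * (1 - x ^+ 2) / ((1 + x * y) * (x + y)).
    by field; rewrite !gt_eqF.
  by rewrite divr_ge0 ?mulr_ge0 ?ltW.
have -> : - gang t (ln x + ln y) = atan A.
  rewrite /gang -atanN expRD !lnK ?posrE// /A; congr atan.
  by field; rewrite !gt_eqF// addrC.
have -> : - gang t (ln x - ln y) = atan B.
  rewrite /gang -atanN expRD expRN !lnK ?posrE// /B; congr atan.
  by field; rewrite !gt_eqF.
rewrite -acos_atanD// -/sA -/sB; congr acos.
have -> : X = Z * (1 + x * y) * (1 + A ^+ 2) / (x + y) - 1.
  have -> : X = (X + 1) - 1 by ring.
  by rewrite XA /Z; field; rewrite !gt_eqF.
by rewrite /Z /A /B; field; rewrite !gt_eqF.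
Qed.

Lemma euclidean_angle (th a b : R) : 0 < th < pi -> 0 < a -> 0 < b ->
  inner_angle Euclidean (edge_length Euclidean th a b) a b =
  atan (tan (th / 2)) - gang (tan (th / 2)) (ln a - ln b).
Proof.
move=> th0 a0 b0; rewrite /inner_angle /edge_length cos_half_tan//.
have := tan_half_gt0 th0; set t := tan _; clearbody t => t0.
have ab0 : 0 < a + b by rewrite addr_gt0.
(* The law of tangents; the half-sum of the two angles at the centers is Theta / 2, with tangent
   [t], whatever the radii. *)
pose B := t * ((b - a) / (a + b)).
have -> : - gang t (ln a - ln b) = atan B.
  rewrite /gang -atanN expRD expRN !lnK ?posrE// /B; congr atan.
  by field; rewrite !gt_eqF.
have AB : 0 <= t + B.
  have -> : t + B = 2 * t * b / (a + b) by rewrite /B; field; rewrite gt_eqF.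
  by rewrite divr_ge0 ?mulr_ge0 ?ltW.
have t2 : 0 < 1 + t ^+ 2 by rewrite ltr_wpDr// sqr_ge0.
have B2 : 0 < 1 + B ^+ 2 by rewrite ltr_wpDr// sqr_ge0.
pose sA := Num.sqrt (1 + t ^+ 2); pose sB := Num.sqrt (1 + B ^+ 2).
have sA0 : 0 < sA by rewrite sqrtr_gt0.
have sB0 : 0 < sB by rewrite sqrtr_gt0.
have sA2 : sA ^+ 2 = 1 + t ^+ 2 by rewrite sqr_sqrtr// ltW.
have sB2 : sB ^+ 2 = 1 + B ^+ 2 by rewrite sqr_sqrtr// ltW.
pose L := a ^+ 2 + b ^+ 2 + 2 * a * b * ((1 - t ^+ 2) / (1 + t ^+ 2)).
have LE : L = ((a + b) * sB / sA) ^+ 2.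
  by rewrite !exprMn exprVn sA2 sB2 /L /B; field; rewrite !gt_eqF.
have L0 : 0 < (a + b) * sB / sA by rewrite divr_gt0 ?mulr_gt0.
rewrite -/L LE sqrtr_sqr (gtr0_norm L0) -LE.
rewrite -acos_atanD// -/sA -/sB; congr acos.
have -> : L + a ^+ 2 - b ^+ 2 = 2 * a * (a + b) * (1 - t * B) / sA ^+ 2.
  by rewrite sA2 /L /B; field; rewrite !gt_eqF.
by field; rewrite !gt_eqF.
Qed.

End Geometry.

(** * The flow in logarithmic coordinates *)

Section Coordinates.
Context {R : realType}.
Local Notation is_d f x d := (is_derive x (1 : R) f d).

Definition udom (bg : background) (u : R) : Prop :=
  match bg with Hyperbolic => u < 0 | Euclidean => True end.

(* The derivative of the radius with respect to its logarithmic coordinate. *)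
Definition rspeed (bg : background) (r : R) : R :=
  match bg with Hyperbolic => sinh r | Euclidean => r end.

Lemma rspeed_gt0 bg (r : R) : 0 < r -> 0 < rspeed bg r.
Proof. by case: bg => // r0; exact: sinh_gt0. Qed.

Lemma rspeed_sqr bg (r : R) : rspeed bg r ^+ 2 = flow_weight bg r.
Proof. by case: bg. Qed.

Lemma ucoord_dom bg (r : R) : 0 < r -> udom bg (ucoord bg r).
Proof.
case: bg => //= r0; have /andP[t0 t1] := thalf_itv r0.
by rewrite -/(thalf r) -ltr_expR lnK ?posrE// expR0.
Qed.

Lemma ucoordK bg (r : R) : 0 < r -> radius bg (ucoord bg r) = r.
Proof.
case: bg => /= r0; last by rewrite lnK.
have /andP[t0 t1] := thalf_itv r0.
rewrite -/(thalf r) lnK ?posrE//.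
have -> : (1 + thalf r) / (1 - thalf r) = expR r; last by rewrite expRK.
have E1 := expRD1_gt0 r; rewrite /thalf; field.
by rewrite !gt_eqF//; lra.
Qed.

Lemma radius_gt0 bg (u : R) : udom bg u -> 0 < radius bg u.
Proof.
case: bg => /= [u0|_]; last exact: expR_gt0.
have E0 := expR_gt0 u; have E1 : expR u < 1 by rewrite -expR0 ltr_expR.
by rewrite ln_gt0// ltr_pdivlMr; lra.
Qed.

Lemma radiusK bg (u : R) : udom bg u -> ucoord bg (radius bg u) = u.
Proof.
case: bg => /= [u0|_]; last by rewrite expRK.
have E0 := expR_gt0 u; have E1 : expR u < 1 by rewrite -expR0 ltr_expR.
rewrite lnK ?posrE ?divr_gt0; [|lra..].
rewrite -[RHS]expRK; congr ln; field.
by rewrite !gt_eqF//; lra.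
Qed.

Lemma is_d_ucoord bg (r : R) : 0 < r ->
  is_d (ucoord bg) r (rspeed bg r)^-1.
Proof.
case: bg => /= r0; last exact: is_derive1_ln.
have /andP[t0 t1] := thalf_itv r0.
have E1 : expR r + 1 != 0 by rewrite gt_eqF// expRD1_gt0.
have E2 : 1 < expR r by rewrite -expR0 ltr_expR.
have D1 := is_dB (is_derive_expR r) (is_d_cst 1 r).
have D2 := is_dD (is_derive_expR r) (is_d_cst 1 r).
have D3 := is_dM D1 (is_dV D2 E1).
apply: is_d_eq (is_d_comp D3 (is_derive1_ln t0)) _.
rewrite /thalf /sinh expRN; field.
have E3 : 0 < expR r * expR r - 1 by nra.
by rewrite E1 !gt_eqF//; lra.
Qed.

Lemma is_d_radius bg (u : R) : udom bg u ->
  is_d (radius bg) u (rspeed bg (radius bg u)).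
Proof.
case: bg => /= [u0|_]; last exact: is_derive_expR.
have E0 := expR_gt0 u; have E1 : expR u < 1 by rewrite -expR0 ltr_expR.
have E2 : 1 - expR u != 0 by rewrite gt_eqF ?subr_gt0.
have Q0 : 0 < (1 + expR u) / (1 - expR u) by rewrite divr_gt0; lra.
have D1 := is_dB (is_d_cst 1 u) (is_derive_expR u).
have D2 := is_dD (is_d_cst 1 u) (is_derive_expR u).
have D3 := is_dM D2 (is_dV D1 E2).
apply: is_d_eq (is_d_comp D3 (is_derive1_ln Q0)) _.
rewrite /sinh expRN lnK ?posrE//; field.
by rewrite !gt_eqF//; lra.
Qed.

End Coordinates.

(** * Curvature and its Jacobian as sums over darts *)

Section AngleSystem.
Context {R : realType} (bg : background) (N : nat) (T : triangulation N).
Variables (tau : tri_edge T -> R) (k : 'I_N -> R).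
Local Notation is_d f x d := (is_derive x (1 : R) f d).
Local Notation dart := (tri_edge T * bool)%type.
Implicit Types (u v w : 'I_N -> R) (d : dart).

Definition vsum v d : R := v (tri_src d) + v (tri_tgt d).
Definition vdiff v d : R := v (tri_src d) - v (tri_tgt d).

Definition ang u d : R :=
  - sgang bg (tau d.1) (vsum u d) - gang (tau d.1) (vdiff u d).

(* [kap] is the curvature defect K - k, and [lap u] is the Jacobian dK/du. *)
Definition kap u (i : 'I_N) : R :=
  2 * pi - \sum_(d | tri_src d == i) 2 * ang u d - k i.

Definition lapt u v d : R :=
  dsgang bg (tau d.1) (vsum u d) * vsum v d + dgang (tau d.1) (vdiff u d) * vdiff v d.

Definition lap u v (i : 'I_N) : R := \sum_(d | tri_src d == i) 2 * lapt u v d.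

Definition vel u (i : 'I_N) : R := - lap u (kap u) i.

Lemma dart_revK : involutive (@dart_rev (tri_edge T)).
Proof. by case=> e b; rewrite /dart_rev/= negbK. Qed.

Lemma vsum_rev v d : vsum v (dart_rev d) = vsum v d.
Proof. by rewrite /vsum /tri_tgt dart_revK addrC. Qed.

Lemma vdiff_rev v d : vdiff v (dart_rev d) = - vdiff v d.
Proof. by rewrite /vdiff /tri_tgt dart_revK opprB. Qed.

Lemma sum_rev (F : dart -> R) : \sum_d F d = \sum_d F (dart_rev d).
Proof. by rewrite (reindex_inj (inv_inj dart_revK)). Qed.

Lemma sum_src (w : 'I_N -> R) (F : dart -> R) :
  \sum_i w i * \sum_(d | tri_src d == i) F d = \sum_d w (tri_src d) * F d.
Proof.
rewrite [RHS](partition_big (@tri_src _ T) predT)//=.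
apply: eq_bigr => i _; rewrite mulr_sumr; apply: eq_bigr => d /eqP ->//.
Qed.

(** Pair each dart with its reverse: [vsum] is invariant, [vdiff] changes sign and [dgang] is even,
    so the factor 2 is absorbed. Symmetry and positivity of the Jacobian can be read off. *)
Lemma lap_quad u v w :
  \sum_i w i * lap u v i = \sum_d
    (dsgang bg (tau d.1) (vsum u d) * (vsum w d * vsum v d) +
     dgang (tau d.1) (vdiff u d) * (vdiff w d * vdiff v d)).
Proof.
rewrite sum_src.
have -> : \sum_d w (tri_src d) * (2 * lapt u v d) =
    \sum_d w (tri_src d) * lapt u v d + \sum_d w (tri_src d) * lapt u v d.
  by rewrite -big_split; apply: eq_bigr => d _ /=; ring.
rewrite [X in _ + X]sum_rev -big_split; apply: eq_bigr => d _ /=.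
rewrite /lapt vsum_rev !vdiff_rev vsum_rev dgangN /= [vsum w d]/vsum [vdiff w d]/vdiff /tri_tgt; ring.
Qed.

Lemma lap_sym u v w : \sum_i w i * lap u v i = \sum_i v i * lap u w i.
Proof. by rewrite !lap_quad; apply: eq_bigr => d _; ring. Qed.

Lemma is_d_sgang (t s : R) : is_d (sgang bg t) s (dsgang bg t s).
Proof. by case: bg => /=; [exact: is_d_gang|exact: is_d_cst]. Qed.

Lemma is_d_vsum (U : R -> 'I_N -> R) (U' : 'I_N -> R) (x : R) d :
  (forall i, is_d (fun y => U y i) x (U' i)) ->
  is_d (fun y => vsum (U y) d) x (vsum U' d).
Proof. by move=> H; exact: is_dD (H _) (H _). Qed.

Lemma is_d_vdiff (U : R -> 'I_N -> R) (U' : 'I_N -> R) (x : R) d :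
  (forall i, is_d (fun y => U y i) x (U' i)) ->
  is_d (fun y => vdiff (U y) d) x (vdiff U' d).
Proof. by move=> H; exact: is_dB (H _) (H _). Qed.

Lemma is_d_kap (U : R -> 'I_N -> R) (U' : 'I_N -> R) (x : R) j :
  (forall i, is_d (fun y => U y i) x (U' i)) ->
  is_d (fun y => kap (U y) j) x (lap (U x) U' j).
Proof.
move=> H.
have A d : is_d (fun y => 2 * ang (U y) d) x (- (2 * lapt (U x) U' d)).
  have D1 := is_d_comp (is_d_vsum d H) (is_d_sgang (tau d.1) _).
  have D2 := is_d_comp (is_d_vdiff d H) (is_d_gang (tau d.1) _).
  apply: is_d_eq (is_dZ 2 (is_dB (is_dN D1) D2)) _.
  by rewrite /lapt; ring.
have S := is_d_sum (fun d => tri_src d == j) A.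
apply: is_d_eq (is_dB (is_dB (is_d_cst (2 * pi) x) S) (is_d_cst (k j) x)) _.
by rewrite sumrN opprK add0r subr0.
Qed.

Lemma lapZ u v (c : R) i : lap u (fun j => c * v j) i = c * lap u v i.
Proof.
rewrite /lap mulr_sumr; apply: eq_bigr => d _; rewrite /lapt /vsum /vdiff; ring.
Qed.

End AngleSystem.

(** * Curvature and flow field rewritten in the logarithmic coordinates *)

Section FlowField.
Context {R : realType} (bg : background) (N : nat) (T : triangulation N).
Variables (Theta : tri_edge T -> R) (k : 'rV[R]_N).
Hypothesis Theta_range : forall e, 0 < Theta e < pi.
Local Notation is_d f x d := (is_derive x (1 : R) f d).
Let tau e := tan (Theta e / 2).
Let kv i := k 0 i.
Let uc (r : 'rV[R]_N) i := ucoord bg (r 0 i).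

Lemma dart_angleE (r : 'rV[R]_N) d : positive_vec r ->
  dart_angle bg Theta r d = ang bg tau (uc r) d.
Proof.
move=> r0; rewrite /dart_angle /ang /vsum /vdiff /uc.
move: bg; case; first exact: hyperbolic_angle.
by rewrite euclidean_angle//= opprK.
Qed.

Lemma curvatureE (r : 'rV[R]_N) j : positive_vec r ->
  curvature bg Theta j r = kap bg tau kv (uc r) j + k 0 j.
Proof.
move=> r0; rewrite /kap subrK /curvature.
by congr (_ - _); apply: eq_bigr => d _; rewrite dart_angleE.
Qed.

Lemma derive_curvature (r : 'rV[R]_N) i j : positive_vec r ->
  'D_(delta_mx 0 i) (curvature bg Theta j) r =
  (rspeed bg (r 0 i))^-1 * lap bg tau (uc r) (fun l => (l == i)%:R) j.
Proof.
move=> r0.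
pose U (h : R) l := ucoord bg (r 0 l + (l == i)%:R * h).
have U0 : U 0 = uc r by apply/funext => l; rewrite /U mulr0 addr0.
have dU l : is_d (fun h => U h l) 0 ((rspeed bg (r 0 i))^-1 * (l == i)%:R).
  have D1 := is_dD (is_d_cst (r 0 l) 0) (is_dZ ((l == i)%:R) (is_d_id 0)).
  have P : 0 < r 0 l + (l == i)%:R * 0 by rewrite mulr0 addr0.
  apply: is_d_eq (is_d_comp D1 (is_d_ucoord bg P)) _.
  rewrite mulr0 addr0 add0r mulr1; case: eqP => [->//|_]; by rewrite !mulr0.
have D : is_d (fun h => kap bg tau kv (U h) j + k 0 j) 0
    ((rspeed bg (r 0 i))^-1 * lap bg tau (uc r) (fun l => (l == i)%:R) j).
  apply: is_d_eq (is_dD (is_d_kap bg tau kv j dU) (is_d_cst (k 0 j) 0)) _.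
  by rewrite addr0 lapZ U0.
have D' : is_d (fun h : R => curvature bg Theta j (h *: delta_mx 0 i + r)) 0
    ((rspeed bg (r 0 i))^-1 * lap bg tau (uc r) (fun l => (l == i)%:R) j).
  (* The angle formulas require positive radii; these persist for [|h| < r 0 i]. *)
  apply: is_d_near D; exists (r 0 i) => // h; rewrite subr0 ltr_norml => /andP[h1 _].
  rewrite curvatureE.
    congr (kap _ _ _ _ _ + _); apply/funext => l.
    by rewrite /U /uc !mxE/= addrC mulrC.
  move=> l; rewrite !mxE/=; case: eqP => [->|_]; first by rewrite mulr1; lra.
  by rewrite mulr0 add0r.
case: D' => _ <-; rewrite /derive.
set f := curvature bg Theta j.
suff -> : (fun h : R => h^-1 *: ((f \o shift r) (h *: delta_mx 0 i) - f r)) =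
  (fun h : R => h^-1 *: (((fun h : R => f (h *: delta_mx 0 i + r)) \o shift 0)
    (h *: (1 : R)) - f (0 *: delta_mx 0 i + r))) by [].
by apply/funext => h /=; rewrite [h *: (1 : R)]mulr1 addr0 scale0r add0r.
Qed.

(** The weight is [rspeed] squared and the partial derivative contributes one inverse of [rspeed].
    The flow sums over the curvatures K_j, that is, it applies the transposed Jacobian; [lap_sym]
    turns this into [lap] itself. *)
Lemma flow_fieldE (r : 'rV[R]_N) i : positive_vec r ->
  flow_field bg Theta k r i = rspeed bg (r 0 i) * vel bg tau kv (uc r) i.
Proof.
move=> r0; rewrite /flow_field /vel.
set s := rspeed _ _; have s0 : s != 0 by rewrite gt_eqF// rspeed_gt0.
transitivity (- s * \sum_j kap bg tau kv (uc r) j *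
    lap bg tau (uc r) (fun l => (l == i)%:R) j).
  rewrite mulr_sumr; apply: eq_bigr => j _.
  rewrite derive_curvature// curvatureE// -rspeed_sqr -/s; field.
  exact: s0.
rewrite lap_sym (bigD1 i)//= eqxx mul1r big1 ?addr0 ?mulNr ?mulrN//.
by move=> l /negbTE ->; rewrite mul0r.
Qed.

End FlowField.

(** * Coercivity of the potential *)

Section Coercivity.
Context {R : realType} (N : nat) (T : triangulation N).
Local Notation dart := (tri_edge T * bool)%type.

Lemma finite_lower_bound (I : finType) (P : I -> R -> Prop) :
  (forall i a b, a <= b -> P i b -> P i a) ->
  (forall i, exists2 a : R, 0 < a & P i a) ->
  exists2 a : R, 0 < a & forall i, P i a.
Proof.
move=> Pm H.
have [||a a0 aP] := @finite_bound R I (fun i x => 0 < x /\ P i x^-1).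
- move=> i a b ab [a0 Pa]; have b0 := lt_le_trans a0 ab; split=> //.
  by apply: Pm Pa; rewrite lef_pV2 ?posrE.
- by move=> i; have [a a0 Pa] := H i; exists a^-1; rewrite invr_gt0 invrK.
by exists a^-1; [rewrite invr_gt0|move=> i; have [] := aP i].
Qed.

Definition touches (A : {set 'I_N}) (d : dart) : bool :=
  (tri_src d \in A) || (tri_tgt d \in A).

(* Peel off the lowest positive level of [p] on its support. *)
Lemma layer_cake (c : 'I_N -> R) (th : dart -> R) (eps : R) (p : 'I_N -> R) :
  0 <= eps -> (forall i, 0 <= p i) ->
  (forall A : {set 'I_N}, A != finset.set0 -> (forall i, i \in A -> 0 < p i) ->
    eps + \sum_(i in A) c i <= \sum_(d | touches A d) th d) ->
  forall i, eps * p i <=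
    \sum_d th d * Num.max (p (tri_src d)) (p (tri_tgt d)) - \sum_i c i * p i.
Proof.
move=> eps0; have [n] := ubnP #|[set i | p i != 0]%SET|.
elim: n p => // n IH p; rewrite ltnS => pn p0 H i.
pose A := [set i | p i != 0]%SET.
have inA j : (j \in A) = (0 < p j) by rewrite inE lt_neqAle p0 andbT eq_sym.
have [A0|A0] := eqVneq A finset.set0.
  have pz j : p j = 0.
    by have := finset.in_set0 j; rewrite -A0 inE => /negbFE/eqP.
  rewrite !big1 ?pz ?mulr0 ?subr0// => [j _|d _]; first by rewrite pz mulr0.
  by rewrite !pz maxxx mulr0.
have [m mA mmin] : exists2 m, m \in A & forall j, j \in A -> p m <= p j.
  have [j0 j0A] := set0Pn _ A0.
  case: (@arg_minP _ _ _ j0 (fun j => j \in A) p j0A) => m mA mmin.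
  by exists m.
have m0 : 0 < p m by rewrite -inA.
(* [m] minimizes [p] on its support [A], so [q] is nonnegative and its support has lost [m]. *)
pose q j := p j - p m * (j \in A)%:R.
have qE j : p j = q j + p m * (j \in A)%:R by rewrite /q subrK.
have q0 j : 0 <= q j.
  rewrite /q; case: (boolP (j \in A)) => jA; rewrite ?mulr1 ?mulr0 ?subr0//.
  by rewrite subr_ge0 mmin.
have qA j : j \notin A -> q j = 0.
  move=> jA; rewrite /q (negbTE jA) mulr0 subr0.
  by move: jA; rewrite inE negbK => /eqP.
have {}IH : forall i, eps * q i <=
    \sum_d th d * Num.max (q (tri_src d)) (q (tri_tgt d)) - \sum_i c i * q i.
  apply: IH => //.
    apply: leq_trans pn; apply: proper_card; apply/properP; split.
      apply/fintype.subsetP => j; rewrite !inE; apply: contra => pj.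
      by rewrite qA// inE pj.
    by exists m => //; rewrite inE /q mA mulr1 subrr eqxx.
  move=> B B0 Bq; apply: H => // j jB; rewrite -inA.
  by apply/negPn/negP => /qA qj; have := Bq j jB; rewrite qj ltxx.
have HA : eps + \sum_(i in A) c i <= \sum_(d | touches A d) th d.
  by apply: H => // j; rewrite inA.
(* The maximum over the two ends drops by [p m] on each dart that touches [A], and is 0 before and
   after on the others. *)
have -> : \sum_d th d * Num.max (p (tri_src d)) (p (tri_tgt d)) =
  \sum_d th d * Num.max (q (tri_src d)) (q (tri_tgt d)) +
  p m * \sum_(d | touches A d) th d.
  rewrite [X in _ + _ * X]big_mkcond/= mulr_sumr -big_split; apply: eq_bigr => d _ /=.
  rewrite /touches (qE (tri_src d)) (qE (tri_tgt d)).
  have := q0 (tri_src d); have := q0 (tri_tgt d).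
  case: (boolP (tri_src d \in A)) => [_|/qA ->]; case: (boolP (tri_tgt d \in A)) => [_|/qA ->];
  rewrite ?mulr1 ?mulr0 ?addr0 /= => h1 h2.
  - by rewrite -addr_maxl mulrDr [p m * _]mulrC.
  - by rewrite (max_l h2) (max_l (addr_ge0 h2 (ltW m0))) mulrDr [p m * _]mulrC.
  - by rewrite (max_r h1) (max_r (addr_ge0 h1 (ltW m0))) mulrDr [p m * _]mulrC.
  - by [].
have -> : \sum_i c i * p i = \sum_i c i * q i + p m * \sum_(i in A) c i.
  rewrite [X in _ + _ * X]big_mkcond/= mulr_sumr -big_split; apply: eq_bigr => j _ /=.
  by rewrite qE; case: (j \in A); rewrite ?mulr1 ?mulr0 ?addr0// mulrDr [p m * _]mulrC.
have := IH i; have := ler_wpM2l (ltW m0) HA; rewrite mulrDr.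
have : eps * p i <= eps * q i + p m * eps.
  rewrite {1}qE mulrDr lerD2l mulrC mulrAC.
  by rewrite ler_piMr ?mulr_ge0 ?(ltW m0)//; case: (i \in A).
lra.
Qed.

End Coercivity.

(** * The potential of the curvature defect and its growth *)

Section Potential.
Context {R : realType} (bg : background) (N : nat) (T : triangulation N).
Variables (tau : tri_edge T -> R) (k : 'I_N -> R).
Hypothesis tau_gt0 : forall e, 0 < tau e.
Local Notation is_d f x d := (is_derive x (1 : R) f d).
Local Notation dart := (tri_edge T * bool)%type.
Let th (d : dart) : R := 2 * atan (tau d.1).
Let c (i : 'I_N) : R := 2 * pi - k i.
Hypothesis attain : forall A : {set 'I_N}, A != finset.set0 ->
  (bg = Euclidean -> A != [set: 'I_N]%SET) ->
  \sum_(i in A) c i < \sum_(d | touches A d) th d.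
Hypothesis total : bg = Euclidean -> \sum_i c i = \sum_d th d.

(** The same pairing of darts as in [lap_quad]. The right-hand side is visibly the derivative, in
    direction [v], of a sum of one-variable primitives. *)
Lemma kap_sum (u v : 'I_N -> R) : \sum_i kap bg tau k u i * v i =
  \sum_i c i * v i + \sum_d (sgang bg (tau d.1) (vsum u d) * vsum v d +
    gang (tau d.1) (vdiff u d) * vdiff v d).
Proof.
have -> : \sum_i kap bg tau k u i * v i = \sum_i c i * v i -
    \sum_i v i * \sum_(d | tri_src d == i) 2 * ang bg tau u d.
  rewrite -sumrB; apply: eq_bigr => i _; rewrite /kap /c; ring.
congr (_ + _); rewrite sum_src.
have -> : \sum_d v (tri_src d) * (2 * ang bg tau u d) =
  \sum_d v (tri_src d) * ang bg tau u d + \sum_d v (tri_src d) * ang bg tau u d.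
  by rewrite -big_split; apply: eq_bigr => d _ /=; ring.
rewrite [X in _ + X]sum_rev -big_split -sumrN; apply: eq_bigr => d _ /=.
rewrite /ang vsum_rev vdiff_rev gangN /= [vsum v d]/vsum [vdiff v d]/vdiff /tri_tgt; ring.
Qed.

(** From [2 * min x y = x + y - |x - y|]: the primitive [G] contributes [atan t * |x - y|], and [S]
    contributes [- atan t * (x + y)], up to constants. In the hyperbolic case the latter uses
    [|x + y| = - (x + y)]. *)
Lemma edge_potential (t : R) : 0 < t -> exists S G : R -> R,
  [/\ forall s, is_d S s (sgang bg t s), forall s, is_d G s (gang t s) &
   exists C, forall x y : R, (bg = Hyperbolic -> x + y <= 0) ->
     - (2 * atan t) * Num.min x y - C <= S (x + y) + G (x - y)].
Proof.
move=> t0; have [G [HG [C HC]]] := gang_primitive t0.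
have At : 0 <= atan t by rewrite -atan0; apply: le_atan; exact: ltW.
have minE (x y : R) : 2 * Num.min x y = x + y - `|x - y|.
  have [xy|/ltW yx] := leP x y.
    by rewrite ler0_norm ?subr_le0//; ring.
  by rewrite ger0_norm ?subr_ge0//; ring.
case: bg.
  exists G, G; split => //; exists (2 * C) => x y /(_ erefl) xy.
  have := HC (x + y); have := HC (x - y); rewrite (ler0_norm xy).
  have -> : - (2 * atan t) * Num.min x y = - atan t * (2 * Num.min x y) by ring.
  rewrite minE; lra.
exists (fun s => - atan t * s), G; split => //.
  by move=> s; apply: is_d_eq (is_dZ (- atan t) (is_d_id s)) _; rewrite mulr1.
exists C => x y _; have := HC (x - y).
have -> : - (2 * atan t) * Num.min x y = - atan t * (2 * Num.min x y) by ring.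
rewrite minE; lra.
Qed.

(** [M] is the level from which - u is measured. In the Euclidean case [Phi] is invariant under
    adding a constant to u, so it can only control the distance to the maximum of u. *)
Lemma potential : exists Phi : ('I_N -> R) -> R,
  (forall (U : R -> 'I_N -> R) (U' : 'I_N -> R) (x : R),
    (forall i, is_d (fun y => U y i) x (U' i)) ->
    is_d (fun y => Phi (U y)) x (\sum_i kap bg tau k (U x) i * U' i)) /\
  exists2 eps : R, 0 < eps & exists C : R, forall (u : 'I_N -> R) (M : R),
    (forall i, u i <= M) -> (bg = Hyperbolic -> M = 0) ->
    (bg = Euclidean -> exists j, u j = M) ->
    forall i, eps * (M - u i) - C <= Phi u.
Proof.
have /choice[S /choice[G SG]] := fun d : dart => edge_potential (tau_gt0 d.1).
have /choice[C CP] : forall d : dart, exists C, forall x y : R,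
    (bg = Hyperbolic -> x + y <= 0) ->
     - th d * Num.min x y - C <= S d (x + y) + G d (x - y).
  by move=> d; have [] := SG d.
exists (fun u => \sum_i c i * u i + \sum_d (S d (vsum u d) + G d (vdiff u d))).
split.
  move=> U U' x H.
  have A d : is_d (fun y => S d (vsum (U y) d) + G d (vdiff (U y) d)) x
      (sgang bg (tau d.1) (vsum (U x) d) * vsum U' d +
       gang (tau d.1) (vdiff (U x) d) * vdiff U' d).
    have [HS HG _] := SG d.
    exact: is_dD (is_d_comp (is_d_vsum d H) (HS _)) (is_d_comp (is_d_vdiff d H) (HG _)).
  have B i : is_d (fun y => c i * U y i) x (c i * U' i) by exact: is_dZ (H i).
  apply: is_d_eq (is_dD (is_d_sum predT B) (is_d_sum predT A)) _.
  by rewrite kap_sum.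
(* [eps] is a common lower bound for the gaps in the finitely many strict attainability
   inequalities. *)
have [|A|eps eps0 epsP] := @finite_lower_bound R {set 'I_N}
  (fun A eps => A != finset.set0 -> (bg = Euclidean -> A != [set: 'I_N]%SET) ->
    eps + \sum_(i in A) c i <= \sum_(d | touches A d) th d).
- by move=> A a b ab H A0 AT; apply: le_trans (H A0 AT); rewrite lerD2r.
- have [/andP[A0 /implyP AT]|nA] := boolP ((A != finset.set0) &&
    ((if bg is Euclidean then true else false) ==> (A != [set: 'I_N]%SET))).
    exists (\sum_(d | touches A d) th d - \sum_(i in A) c i).
      by rewrite subr_gt0; apply: attain => // E; apply: AT; rewrite E.
    by move=> _ _; rewrite subrK.
  (* For the excluded sets the condition is vacuous and 1 is a default. *)
  exists 1 => // A0 AT; exfalso; move: nA; rewrite A0/=.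
  by move: AT; case: bg => //= -> .
exists eps => //; exists (\sum_d C d) => u M uM hM eM i.
pose p j := M - u j.
have p0 j : 0 <= p j by rewrite subr_ge0.
have := @layer_cake R N T c th eps p (ltW eps0) p0 _ i.
(* In the Euclidean case some [p j] vanishes, so a set on which [p] is positive cannot be the whole
   vertex set, where the gap is zero. *)
have HA (A : {set 'I_N}) : A != finset.set0 -> (forall i, i \in A -> 0 < p i) ->
    eps + \sum_(i in A) c i <= \sum_(d | touches A d) th d.
  move=> A0 Ap; apply: epsP => // /eM[j uj]; apply/negP => /eqP AT.
  by have := Ap j; rewrite AT inE /p uj subrr ltxx => /(_ erefl).
move=> /(_ HA) L.
have maxE d : Num.max (p (tri_src d)) (p (tri_tgt d)) =
    M - Num.min (u (tri_src d)) (u (tri_tgt d)).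
  rewrite /p; have [h|/ltW h] := leP (u (tri_src d)) (u (tri_tgt d)).
    by rewrite max_l// lerB.
  by rewrite max_r// lerB.
have E1 : \sum_d th d * Num.max (p (tri_src d)) (p (tri_tgt d)) =
    M * \sum_d th d + \sum_d - th d * Num.min (u (tri_src d)) (u (tri_tgt d)).
  by rewrite mulr_sumr -big_split; apply: eq_bigr => d _; rewrite maxE /=; ring.
have E2 : \sum_j c j * p j = M * \sum_j c j - \sum_j c j * u j.
  by rewrite mulr_sumr -sumrB; apply: eq_bigr => j _; rewrite /p; ring.
(* The terms introduced by the shift cancel: either [M = 0] or the totals agree. *)
have E3 : M * \sum_d th d = M * \sum_j c j.
  by move: hM eM total; case: bg => [/(_ erefl) ->|_ _ /(_ erefl) ->]; rewrite ?mul0r.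
have E4 : \sum_d - th d * Num.min (u (tri_src d)) (u (tri_tgt d)) - \sum_d C d <=
    \sum_d (S d (vsum u d) + G d (vdiff u d)).
  rewrite -sumrB; apply: ler_sum => d _; apply: CP => E.
  by have M0 := hM E; have := uM (tri_src d); have := uM (tri_tgt d); lra.
move: L; rewrite E1 E2 E3 -/(p i); lra.
Qed.

End Potential.

(** * Spectral gap *)

Section SpectralGap.
Context {R : realType} (bg : background) (N : nat) (T : triangulation N).
Variables (tau : tri_edge T -> R).
Hypothesis tau_gt0 : forall e, 0 < tau e.
Local Notation dart := (tri_edge T * bool)%type.

(** [tri_next d] is the image of [dart_rev d] under [next \o rev], whose orbits are the vertex
    stars. *)
Lemma src_next (d : dart) : tri_src (tri_next d) = tri_tgt d.
Proof.
apply/esym/tri_srcP; have := fconnect1 (@tri_next _ T \o @dart_rev (tri_edge T)) (dart_rev d).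
by rewrite /= dart_revK.
Qed.

Lemma path_variation (v : 'I_N -> R) (D : R) (p : seq dart) (d : dart) :
  (forall d : dart, `|vdiff v d| <= D) ->
  path [rel x y : dart | (y == tri_next x) || (y == dart_rev x)] d p ->
  `|v (tri_src (last d p)) - v (tri_src d)| <= (size p)%:R * D.
Proof.
move=> HD; elim: p d => [|e p IH] d /=; first by rewrite subrr normr0 mul0r.
move=> /andP[de /IH H].
have -> : v (tri_src (last e p)) - v (tri_src d) =
    (v (tri_src (last e p)) - v (tri_src e)) - vdiff v d.
  (* A face step and a reversal both lead to a dart leaving the target of [d]. *)
  have -> : tri_src e = tri_tgt d.
    by case/orP: de => /eqP ->; rewrite ?src_next.
  by rewrite /vdiff; ring.
apply: le_trans (ler_normB _ _) _.
by rewrite -addn1 natrD mulrDl mul1r lerD.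
Qed.

(** With [n] darts, a path without repetition joins any two vertices in fewer than [n] steps, each
    changing [v] by at most the root of [Q]. Mean zero turns this into a bound on each [v i]. The
    [+ 1] in the constant ensures positivity. *)
Lemma poincare : exists2 c : R, 0 < c & forall v : 'I_N -> R,
  \sum_i v i = 0 -> c * \sum_i v i ^+ 2 <= \sum_(d : dart) vdiff v d ^+ 2.
Proof.
pose n : R := #|{: dart}|%:R.
have K0 : 0 < N%:R * n ^+ 2 + 1 :> R by rewrite ltr_wpDl// mulr_ge0// sqr_ge0.
exists (N%:R * n ^+ 2 + 1)^-1; first by rewrite invr_gt0.
move=> v v0; set Q := \sum_(d : dart) _.
have Q0 : 0 <= Q by apply: sumr_ge0 => d _; exact: sqr_ge0.
pose D := Num.sqrt Q.
have HD (d : dart) : `|vdiff v d| <= D.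
  rewrite -sqrtr_sqr ler_wsqrtr// /Q (bigD1 d)//= lerDl.
  by apply: sumr_ge0 => e _; exact: sqr_ge0.
have D0 : 0 <= D by exact: sqrtr_ge0.
have vv i j : `|v i - v j| <= n * D.
  have [d <-] := tri_src_surj T i; have [d' <-] := tri_src_surj T j.
  have /connectP[p pth ->] := tri_connected d' d.
  case: (shortenP pth) => q qp qu _.
  apply: le_trans (path_variation HD qp) _.
  rewrite ler_wpM2r// ler_nat.
  have := max_card (mem (d' :: q)); rewrite (card_uniqP qu) /=.
  exact: ltnW.
have N0 (i : 'I_N) : 0 < N%:R :> R by rewrite ltr0n (leq_trans _ (ltn_ord i)).
have vi i : `|v i| <= n * D.
  rewrite -(ler_pM2l (N0 i)) -[X in X * _](gtr0_norm (N0 i)) -normrM.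
  have -> : N%:R * v i = \sum_j (v i - v j).
    by rewrite sumrB v0 subr0 sumr_const card_ord mulr_natl.
  apply: le_trans (ler_norm_sum _ _ _) _.
  apply: le_trans (ler_sum _ (fun j _ => vv i j)) _.
  by rewrite sumr_const card_ord [leRHS]mulr_natl.
have vi2 i : v i ^+ 2 <= n ^+ 2 * Q.
  rewrite -[Q]sqr_sqrtr// -/D -exprMn -[v i ^+ 2]real_normK ?num_real//.
  by rewrite ler_sqr ?nnegrE// mulr_ge0.
rewrite mulrC ler_pdivrMr//.
apply: le_trans (ler_sum _ (fun i _ => vi2 i)) _.
clear N0; rewrite sumr_const card_ord -mulr_natl; lra.
Qed.

(** On a bounded set the coefficients are bounded below. In the hyperbolic case sums and differences
    together control each [v i], since every vertex is the source of a dart; in the Euclidean case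
    only differences occur and [poincare] is applied. *)
Lemma lap_gap (B : R) : exists2 lam : R, 0 < lam & forall u : 'I_N -> R,
  (forall i, `|u i| <= B) -> forall v : 'I_N -> R,
  (bg = Euclidean -> \sum_i v i = 0) ->
  lam * \sum_i v i ^+ 2 <= \sum_i v i * lap bg tau u v i.
Proof.
have [||w w0 wP] := @finite_lower_bound R (tri_edge T)
    (fun e w => forall s : R, `|s| <= 2 * B -> w <= dgang (tau e) s).
- by move=> e a b ab H s /H; exact: le_trans.
- by move=> e; exact: dgang_ge.
have us u (d : dart) : (forall i, `|u i| <= B) -> `|vsum u d| <= 2 * B.
  move=> uB; apply: le_trans (ler_normD _ _) _.
  by have := uB (tri_src d); have := uB (tri_tgt d); lra.
have ud u (d : dart) : (forall i, `|u i| <= B) -> `|vdiff u d| <= 2 * B.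
  move=> uB; apply: le_trans (ler_normB _ _) _.
  by have := uB (tri_src d); have := uB (tri_tgt d); lra.
case: bg.
  exists w => // u uB v _; rewrite lap_quad.
  apply: (@le_trans _ _ (w * \sum_(d : dart) v (tri_src d) ^+ 2)).
    rewrite ler_pM2l//.
    have -> : \sum_(d : dart) v (tri_src d) ^+ 2 =
        \sum_i v i ^+ 2 * \sum_(d : dart | tri_src d == i) 1.
      rewrite (sum_src (fun i => v i ^+ 2) (fun d : dart => 1)).
      by apply: eq_bigr => d _; rewrite mulr1.
    apply: ler_sum => i _; rewrite ler_peMr ?sqr_ge0//.
    have [d <-] := tri_src_surj T i.
    by rewrite (bigD1 d)//= lerDl; apply: sumr_ge0.
  rewrite mulr_sumr; apply: ler_sum => d _ /=.
  rewrite -!expr2.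
  have h1 := ler_wpM2r (sqr_ge0 (vsum v d)) (wP d.1 _ (us u d uB)).
  have h2 := ler_wpM2r (sqr_ge0 (vdiff v d)) (wP d.1 _ (ud u d uB)).
  apply: le_trans (lerD h1 h2); rewrite -mulrDr ler_pM2l//.
  rewrite /vsum /vdiff; have := sqr_ge0 (v (tri_src d)); have := sqr_ge0 (v (tri_tgt d)); lra.
have [c c0 cP] := poincare; exists (w * c); first exact: mulr_gt0.
move=> u uB v /(_ erefl) v0; rewrite lap_quad -mulrA.
apply: le_trans (ler_wpM2l (ltW w0) (cP v v0)) _.
rewrite mulr_sumr; apply: ler_sum => d _ /=; rewrite mul0r add0r -expr2.
by rewrite ler_wpM2r ?sqr_ge0// wP// ud.
Qed.

End SpectralGap.

(** * Estimates for the vector field *)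

Section BoundedLipschitz.
Context {R : realType} {I : Type}.
Implicit Types f g : (I -> R) -> R.

Lemma bl_cst (c : R) : bounded_lipschitz (fun _ : I -> R => c).
Proof.
exists `|c| => //; split=> // x y d d0 _.
by rewrite subrr normr0 mulr_ge0.
Qed.

Lemma bl_add f g : bounded_lipschitz f -> bounded_lipschitz g ->
  bounded_lipschitz (fun x => f x + g x).
Proof.
move=> [a a0 [fa fl]] [b b0 [gb gl]]; exists (a + b); first exact: addr_ge0.
split=> [x|x y c c0 xy]; first by rewrite (le_trans (ler_normD _ _))// lerD.
rewrite opprD addrACA mulrDl (le_trans (ler_normD _ _))// lerD//.
  exact: fl.
exact: gl.
Qed.

Lemma bl_mul f g : bounded_lipschitz f -> bounded_lipschitz g ->
  bounded_lipschitz (fun x => f x * g x).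
Proof.
move=> [a a0 [fa fl]] [b b0 [gb gl]]; exists (2 * (a * b)).
  by rewrite !mulr_ge0.
have ab0 : 0 <= a * b by rewrite mulr_ge0.
split=> [x|x y c c0 xy].
  rewrite normrM; apply: le_trans (ler_pM _ _ (fa x) (gb x)) _ => //.
  by lra.
have -> : f x * g x - f y * g y = f x * (g x - g y) + (f x - f y) * g y by ring.
apply: le_trans (ler_normD _ _) _; rewrite !normrM.
have h1 := ler_pM (normr_ge0 _) (normr_ge0 _) (fa x) (gl x y c c0 xy).
have h2 := ler_pM (normr_ge0 _) (normr_ge0 _) (fl x y c c0 xy) (gb y).
by apply: le_trans (lerD h1 h2) _; lra.
Qed.

Lemma bl_opp f : bounded_lipschitz f -> bounded_lipschitz (fun x => - f x).
Proof.
move=> [a a0 [fa fl]]; exists a => //; split=> [x|x y c c0 xy].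
  by rewrite normrN.
by rewrite -opprD normrN fl.
Qed.

Lemma bl_sum (J : finType) (P : pred J) (F : J -> (I -> R) -> R) :
  (forall j, bounded_lipschitz (F j)) ->
  bounded_lipschitz (fun x => \sum_(j | P j) F j x).
Proof.
move=> H.
have -> : (fun x => \sum_(j | P j) F j x) = \sum_(j | P j) F j.
  by apply/funext => x; rewrite fct_sumE.
elim/big_ind: _ => [|f g|j _]; [exact: bl_cst|exact: bl_add|exact: H].
Qed.

Lemma bl_comp (g : R -> R) (h : (I -> R) -> R) (a b l : R) :
  (forall s, `|g s| <= a) -> (forall s t : R, `|g s - g t| <= b * `|s - t|) ->
  (forall x y c, 0 <= c -> (forall j, `|x j - y j| <= c) -> `|h x - h y| <= l * c) ->
  bounded_lipschitz (fun x => g (h x)).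
Proof.
move=> ga gl hl.
have a0 : 0 <= a by exact: le_trans (normr_ge0 (g 0)) (ga 0).
have b0 : 0 <= b.
  by have := gl 1 0; rewrite subr0 normr1 mulr1; exact: le_trans.
exists (a + b * `|l|); first by rewrite addr_ge0// mulr_ge0.
split=> [x|x y c c0 xy].
  by rewrite (le_trans (ga _))// lerDl mulr_ge0.
apply: le_trans (gl _ _) _; apply: (@le_trans _ _ (b * `|l| * c)).
  rewrite -mulrA ler_wpM2l//; apply: le_trans (hl _ _ _ c0 xy) _.
  by rewrite ler_wpM2r// ler_norm.
by rewrite ler_wpM2r// lerDr.
Qed.

End BoundedLipschitz.

Section SystemEstimates.
Context {R : realType} (bg : background) (N : nat) (T : triangulation N).
Variables (tau : tri_edge T -> R) (k : 'I_N -> R).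
Hypothesis tau_gt0 : forall e, 0 < tau e.
Local Notation dart := (tri_edge T * bool)%type.

Lemma vsum_lip (d : dart) (x y : 'I_N -> R) (c : R) : 0 <= c ->
  (forall j, `|x j - y j| <= c) -> `|vsum x d - vsum y d| <= 2 * c.
Proof.
move=> c0 H; rewrite /vsum opprD addrACA.
apply: le_trans (ler_normD _ _) _.
by have := H (tri_src d); have := H (tri_tgt d); lra.
Qed.

Lemma vdiff_lip (d : dart) (x y : 'I_N -> R) (c : R) : 0 <= c ->
  (forall j, `|x j - y j| <= c) -> `|vdiff x d - vdiff y d| <= 2 * c.
Proof.
move=> c0 H; have -> : vdiff x d - vdiff y d =
    (x (tri_src d) - y (tri_src d)) - (x (tri_tgt d) - y (tri_tgt d)).
  by rewrite /vdiff; ring.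
apply: le_trans (ler_normB _ _) _.
by have := H (tri_src d); have := H (tri_tgt d); lra.
Qed.

Lemma bl_gang_diff (d : dart) :
  bounded_lipschitz (fun u => gang (tau d.1) (vdiff u d)).
Proof.
have [C C0 HC] := gang_lip (tau_gt0 d.1).
apply: (@bl_comp _ _ _ _ (atan (tau d.1)) C 2) => //.
  by move=> s; exact: gang_bound.
exact: vdiff_lip.
Qed.

Lemma bl_sgang_sum (d : dart) :
  bounded_lipschitz (fun u => sgang bg (tau d.1) (vsum u d)).
Proof.
case: bg => /=; last exact: bl_cst.
have [C C0 HC] := gang_lip (tau_gt0 d.1).
apply: (@bl_comp _ _ _ _ (atan (tau d.1)) C 2) => //.
  by move=> s; exact: gang_bound.
exact: vsum_lip.
Qed.

Lemma bl_dgang_diff (d : dart) :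
  bounded_lipschitz (fun u => dgang (tau d.1) (vdiff u d)).
Proof.
have [C C0 HC] := dgang_lip (tau_gt0 d.1).
apply: (@bl_comp _ _ _ _ (tau d.1 / (2 * dgang_min (tau d.1))) C 2) => //.
  by move=> s; rewrite gtr0_norm ?dgang_gt0// dgang_le.
exact: vdiff_lip.
Qed.

Lemma bl_dsgang_sum (d : dart) :
  bounded_lipschitz (fun u => dsgang bg (tau d.1) (vsum u d)).
Proof.
case: bg => /=; last exact: bl_cst.
have [C C0 HC] := dgang_lip (tau_gt0 d.1).
apply: (@bl_comp _ _ _ _ (tau d.1 / (2 * dgang_min (tau d.1))) C 2) => //.
  by move=> s; rewrite gtr0_norm ?dgang_gt0// dgang_le.
exact: vsum_lip.
Qed.

Lemma bl_kap i : bounded_lipschitz (fun u => kap bg tau k u i).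
Proof.
apply: bl_add; last exact: bl_cst.
apply: bl_add; first exact: bl_cst.
apply/bl_opp/bl_sum => d; apply: bl_mul; first exact: bl_cst.
by apply: bl_add; apply: bl_opp; [exact: bl_sgang_sum|exact: bl_gang_diff].
Qed.

Lemma bl_vel i : bounded_lipschitz (fun u => vel bg tau k u i).
Proof.
apply/bl_opp/bl_sum => d; apply: bl_mul; first exact: bl_cst.
apply: bl_add; apply: bl_mul; [exact: bl_dsgang_sum| |exact: bl_dgang_diff|].
- by apply: bl_add; exact: bl_kap.
- by apply: bl_add; [|apply: bl_opp]; exact: bl_kap.
Qed.

Lemma kap_bound : exists2 K : R, 0 < K & forall u i, `|kap bg tau k u i| <= K.
Proof.
have [||K K0 H] := @finite_bound R 'I_N (fun i K => forall u, `|kap bg tau k u i| <= K).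
- by move=> i a b ab H u; exact: le_trans ab.
- by move=> i; have [K _ [HK _]] := bl_kap i; exists K.
by exists K.
Qed.

Lemma kap_lip : exists2 L : R, 0 < L & forall i u v (c : R), 0 <= c ->
  (forall j, `|u j - v j| <= c) -> `|kap bg tau k u i - kap bg tau k v i| <= L * c.
Proof.
have [||K K0 H] := @finite_bound R 'I_N (fun i K => forall u v (c : R), 0 <= c ->
  (forall j, `|u j - v j| <= c) -> `|kap bg tau k u i - kap bg tau k v i| <= K * c).
- move=> i a b ab H u v c c0 uv; apply: le_trans (H u v c c0 uv) _.
  by rewrite ler_wpM2r.
- by move=> i; have [K _ [_ HK]] := bl_kap i; exists K.
by exists K.
Qed.

Lemma sum_src_le (i : 'I_N) (F : dart -> R) (c : R) : 0 <= c ->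
  (forall d, tri_src d = i -> F d <= c) ->
  \sum_(d | tri_src d == i) F d <= #|{: dart}|%:R * c.
Proof.
move=> c0 H; apply: (@le_trans _ _ (\sum_(d : dart) c)); last first.
  by rewrite sumr_const mulr_natl.
rewrite big_mkcond/=; apply: ler_sum => d _.
by case: eqP => [/H|_].
Qed.

Lemma lap_bound : exists2 W : R, 0 < W & forall u v (c : R) i,
  (forall j, `|v j| <= c) -> `|lap bg tau u v i| <= W * c.
Proof.
have [||W W0 HW] := @finite_bound R (tri_edge T) (fun e W => forall s : R, dgang (tau e) s <= W).
- by move=> e a b ab H s; exact: le_trans ab.
- by move=> e; exists (tau e / (2 * dgang_min (tau e))) => s; exact: dgang_le.
have n0 : 0 <= #|{: dart}|%:R :> R by [].
exists (#|{: dart}|%:R * (2 * (W * 2 + W * 2)) + 1).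
  by rewrite ltr_wpDl// mulr_ge0// ?mulr_ge0// addr_ge0 ?mulr_ge0// ltW.
move=> u v c i vc.
have c0 : 0 <= c by apply: le_trans (vc i).
apply: (@le_trans _ _ (#|{: dart}|%:R * (2 * (W * 2 + W * 2) * c))); last first.
  by rewrite mulrA ler_wpM2r// lerDl.
apply: le_trans (ler_norm_sum _ _ _) _.
apply: sum_src_le => [|d _].
  by rewrite !mulr_ge0// addr_ge0 ?mulr_ge0// ltW.
have d1 : `|dsgang bg (tau d.1) (vsum u d)| <= W.
  case: bg => /=; first by rewrite gtr0_norm ?dgang_gt0.
  by rewrite normr0 ltW.
have d2 : `|dgang (tau d.1) (vdiff u d)| <= W by rewrite gtr0_norm ?dgang_gt0.
have v1 : `|vsum v d| <= 2 * c.
  apply: le_trans (ler_normD _ _) _.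
  by have := vc (tri_src d); have := vc (tri_tgt d); lra.
have v2 : `|vdiff v d| <= 2 * c.
  apply: le_trans (ler_normB _ _) _.
  by have := vc (tri_src d); have := vc (tri_tgt d); lra.
rewrite normrM (ger0_norm (ler0n _ 2)) -mulrA ler_pM2l//.
have h1 := ler_pM (normr_ge0 _) (normr_ge0 _) d1 v1.
have h2 := ler_pM (normr_ge0 _) (normr_ge0 _) d2 v2.
apply: le_trans (ler_normD _ _) _; move: h1 h2; rewrite -!normrM => h1 h2.
by apply: le_trans (lerD h1 h2) _; lra.
Qed.

Lemma lap_ge0 u v : 0 <= \sum_i v i * lap bg tau u v i.
Proof.
rewrite lap_quad; apply: sumr_ge0 => d _; rewrite -!expr2.
apply: addr_ge0; apply: mulr_ge0; rewrite ?sqr_ge0//; last first.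
  by rewrite ltW// dgang_gt0.
by case: bg => //=; rewrite ltW// dgang_gt0.
Qed.

(* When the radius at [i] is large, the curvature at [i] is almost 2 pi while
   the off-diagonal coefficients of the Laplacian at [i] are negligible against
   the diagonal one. *)
Lemma vel_lt0 : bg = Hyperbolic -> (forall i, k i < 2 * pi) ->
  exists2 eta : R, 0 < eta & forall u i, - eta <= u i <= 0 ->
    vel bg tau k u i < 0.
Proof.
move=> bgE kpi.
have [K K0 HK] := kap_bound.
have [||L L0 HL] := @finite_bound R (tri_edge T)
    (fun e L => forall x y : R, `|gang (tau e) x - gang (tau e) y| <= L * `|x - y|).
- move=> e a b ab H x y; apply: le_trans (H x y) _; exact: ler_wpM2r.
- by move=> e; have [C _ HC] := gang_lip (tau_gt0 e); exists C.
have [||C C0 HC] := @finite_bound R (tri_edge T) (fun e C => forall x y : R, x <= 0 ->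
    `|dgang (tau e) (x + y) - dgang (tau e) (x - y)| <=
    C * `|x| * (dgang (tau e) (x + y) + dgang (tau e) (x - y))).
- move=> e a b ab H x y x0; apply: le_trans (H x y x0) _.
  apply: ler_wpM2r; first by rewrite addr_ge0// ltW// dgang_gt0.
  exact: ler_wpM2r.
- by move=> e; have [C _ HC] := dgang_diff_sum (tau_gt0 e); exists C.
have [||eps eps0 Heps] := @finite_lower_bound R 'I_N (fun i e => e <= 2 * pi - k i).
- by move=> i a b ab; exact: le_trans ab.
- by move=> i; exists (2 * pi - k i); rewrite ?subr_gt0.
pose n : R := #|{: dart}|%:R; have n0 : 0 <= n by exact: ler0n.
(* The first term collects the angle sum at [i], the second the off-diagonal part of the Laplacian;
   [eta * Q = eps / 2] leaves half of the gap [eps]. *)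
pose Q := n * (4 * L) + C * K.
have Q0 : 0 < Q by rewrite ltr_wpDl ?mulr_gt0// !mulr_ge0// ltW.
exists (eps / (2 * Q)); first by rewrite divr_gt0// mulr_gt0.
set eta := eps / _; have etaE : eta * Q = eps / 2.
  by rewrite /eta; field; rewrite gt_eqF.
have eta0 : 0 < eta by rewrite divr_gt0// mulr_gt0.
clearbody eta.
move=> u i /andP[ui1 ui0].
have nui : `|u i| <= eta by rewrite ler0_norm//; lra.
have kapi : eps - n * (4 * L) * eta <= kap bg tau k u i.
  have : \sum_(d | tri_src d == i) 2 * ang bg tau u d <= n * (4 * L * eta).
    apply: sum_src_le => [|d di]; first by rewrite !mulr_ge0// ltW.
    rewrite /ang bgE /= /vsum /vdiff di.
    set x := u i in nui ui0 *; set y := u _.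
    (* [gang] is odd, so the two halves of the angle cancel at [x = 0] and the angle is O(|x|)
       uniformly in [y]. *)
    have -> : - gang (tau d.1) (x + y) - gang (tau d.1) (x - y) =
        gang (tau d.1) (y - x) - gang (tau d.1) (x + y).
      by rewrite -(opprB x y) gangN addrC.
    have := le_trans (ler_norm _) (HL d.1 (y - x) (x + y)).
    have -> : y - x - (x + y) = - (2 * x) by ring.
    rewrite normrN normrM (ger0_norm (ler0n _ 2)) => h.
    have := ler_wpM2l (ltW L0) nui; lra.
  by rewrite /kap; have := Heps i; lra.
have ki : 0 < kap bg tau k u i - C * eta * K.
  have : n * (4 * L) * eta + C * eta * K = eps / 2 by rewrite -etaE /Q; ring.
  by lra.
have lt d : tri_src d = i -> 0 < 2 * lapt bg tau u (kap bg tau k u) d.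
  move=> di; rewrite mulr_gt0// /lapt bgE /= /vsum /vdiff di -bgE.
  set x := u i in nui ui0 *; set y := u _; set a := kap _ _ _ _ i; set b := kap _ _ _ _ _.
  set A := dgang _ (x + y); set B := dgang _ (x - y).
  have A0 : 0 < A by exact: dgang_gt0.
  have B0 : 0 < B by exact: dgang_gt0.
  have := HC d.1 x y ui0; rewrite -/A -/B => h1.
  have h2 : `|(A - B) * b| <= C * eta * (A + B) * K.
    rewrite normrM; apply: ler_pM => //; last exact: HK.
    apply: le_trans h1 _; apply: ler_wpM2r; first by rewrite addr_ge0// ltW.
    by rewrite ler_pM2l.
  have h3 := mulr_gt0 (addr_gt0 A0 B0) ki.
  move: h2; rewrite ler_norml => /andP[h2 _].
  by rewrite -/a in h3; lra.
rewrite /vel oppr_lt0 /lap.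
have [d0 d0i] := tri_src_surj T i.
rewrite (bigD1 d0) ?d0i//= ltr_pwDl ?lt//.
by apply: sumr_ge0 => d /andP[/eqP di _]; rewrite ltW// lt.
Qed.

End SystemEstimates.

(** * Convergence in logarithmic coordinates *)

Section Convergence.
Context {R : realType} (bg : background) (N : nat) (T : triangulation N).
Variables (tau : tri_edge T -> R) (k : 'I_N -> R).
Hypothesis tau_gt0 : forall e, 0 < tau e.
Local Notation is_d f x d := (is_derive x (1 : R) f d).
Local Notation dart := (tri_edge T * bool)%type.
Let th (d : dart) : R := 2 * atan (tau d.1).
Let c (i : 'I_N) : R := 2 * pi - k i.
Hypothesis attain : forall A : {set 'I_N}, A != finset.set0 ->
  (bg = Euclidean -> A != [set: 'I_N]%SET) ->
  \sum_(i in A) c i < \sum_(d | touches A d) th d.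
Hypothesis total : bg = Euclidean -> \sum_i c i = \sum_d th d.
Hypothesis k_lt : forall i, k i < 2 * pi.

(* The vector field [vel] extends to a globally Lipschitz one beyond infinite
   hyperbolic radii, and clipping keeps the barrier at [u i = 0] effective. *)
Definition clip (u : 'I_N -> R) (i : 'I_N) : R :=
  match bg with Hyperbolic => Num.min (u i) 0 | Euclidean => u i end.

Lemma clip_id u : (forall i, udom bg (u i)) -> clip u = u.
Proof.
rewrite /udom /clip => H; apply/funext => i; move: H; case: bg => //= /(_ i) h.
by rewrite min_l// ltW.
Qed.

Lemma bl_clip (f : ('I_N -> R) -> R) :
  bounded_lipschitz f -> bounded_lipschitz (fun u => f (clip u)).
Proof.
move=> [a a0 [fa fl]]; exists a => //; split=> // x y e e0 xy.
apply: fl => // j; rewrite /clip; case: bg => //.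
apply: le_trans (xy j); rewrite !minElt.
have [x0|x0] := ltP (x j) 0; have [y0|y0] := ltP (y j) 0 => //.
- by rewrite subr0 ltr0_norm// ler0_norm; lra.
- by rewrite sub0r normrN ltr0_norm// ger0_norm; lra.
- by rewrite subrr normr0.
Qed.

Lemma le_of_exp (x y C mu : R) : 0 < mu ->
  (forall t : R, 0 <= t -> x <= y + C * expR (- mu * t)) -> x <= y.
Proof.
move=> mu0 H; rewrite leNgt; apply/negP => yx.
have C0 : 0 < C by have := H 0 (lexx _); rewrite mulr0 expR0; lra.
have xy : 0 < x - y by rewrite subr_gt0.
(* At this time the exponential is [expR (- (C / (x - y)))], and [1 + z <= expR z] suffices for the
   contradiction. *)
have t0 : 0 <= C / (mu * (x - y)) by rewrite divr_ge0 ?mulr_ge0 ?ltW.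
have := H _ t0; set t := _ / _.
have -> : - mu * t = - (C / (x - y)) by rewrite /t; field; rewrite !gt_eqF.
rewrite expRN; have := expR_ge1Dx (C / (x - y)).
set E := expR _ => E1.
have q0 : 0 < C / (x - y) by rewrite divr_gt0.
have E0 : 0 < E by lra.
rewrite -lerBlDl ler_pdivlMr// => h.
have : (x - y) * (1 + C / (x - y)) <= (x - y) * E by rewrite ler_pM2l.
have -> : (x - y) * (1 + C / (x - y)) = (x - y) + C by field; rewrite gt_eqF.
lra.
Qed.

Section Solution.
Variable u : R -> 'I_N -> R.
Hypothesis u_flow : forall t : R, 0 <= t -> forall i,
  is_d (fun s => u s i) t (vel bg tau k (clip (u t)) i).
Hypothesis u_init : forall i, udom bg (u 0 i).

Lemma flow_barrier : bg = Hyperbolic ->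
  exists2 eta : R, 0 < eta & forall t : R, 0 <= t -> forall i, u t i <= - eta.
Proof.
move=> bgE; have [eta eta0 vel0] := vel_lt0 tau_gt0 bgE k_lt.
have [||z z0 zP] := @finite_lower_bound R 'I_N (fun i z => u 0 i <= - z).
- by move=> i a b ab H; apply: le_trans H _; rewrite lerN2.
- move=> i; exists (- u 0 i); last by rewrite opprK.
  by have := u_init i; rewrite bgE /= oppr_gt0.
exists (Num.min eta z); first by rewrite lt_min eta0.
move=> t t0 i.
apply: (@barrier R (fun s => u s i) (fun t => vel bg tau k (clip (u t)) i)) => //.
- by apply: le_trans (zP i) _; rewrite lerN2 ge_min lexx orbT.
- by move=> s s0; exact: u_flow.
(* At this point [u s i] might be positive; clipping brings it back into [[- eta, 0]], where the
   velocity is negative. *)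
- move=> s s0; rewrite ltrNl lt_min => /andP[h1 h2]; apply: vel0.
  by rewrite /clip bgE le_min ge_min lexx orbT andbT; apply/andP; split; lra.
Qed.

Lemma flow_udom (t : R) : 0 <= t -> forall i, udom bg (u t i).
Proof.
have := flow_barrier; rewrite /udom; case: bg => // /(_ erefl)[eta eta0 H] t0 i.
by apply: le_lt_trans (H t t0 i) _; rewrite oppr_lt0.
Qed.

Lemma flow_vel (t : R) : 0 <= t -> forall i, is_d (fun s => u s i) t (vel bg tau k (u t) i).
Proof. by move=> t0 i; rewrite -{1}(clip_id (flow_udom t0)); exact: u_flow. Qed.

Lemma flow_bounded : exists B : R, forall t : R, 0 <= t -> forall i, `|u t i| <= B.
Proof.
have [Phi [dPhi [eps eps0 [C PhiC]]]] := potential tau_gt0 attain total.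
have Phi0 (t : R) : 0 <= t -> Phi (u t) <= Phi (u 0).
  move=> t0; apply: (ge_of_is_d (f := fun s => Phi (u s)) t0).
    by move=> x /andP[x0 _]; exact: dPhi (flow_vel x0).
  move=> x _ /=; rewrite -oppr_ge0 -sumrN.
  apply: le_trans (lap_ge0 bg tau_gt0 (u x) (kap bg tau k (u x))) _.
  by apply: ler_sum => i _; rewrite /vel mulrN opprK.
pose D := (Phi (u 0) + C) / eps.
have key (M t : R) : 0 <= t -> (forall i, u t i <= M) -> (bg = Hyperbolic -> M = 0) ->
    (bg = Euclidean -> exists j, u t j = M) -> forall i, M - u t i <= D.
  move=> t0 h1 h2 h3 i; rewrite /D ler_pdivlMr// mulrC.
  by have := PhiC _ _ h1 h2 h3 i; have := Phi0 t t0; lra.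
have hypc : bg = Hyperbolic -> exists B : R, forall t : R, 0 <= t -> forall i, `|u t i| <= B.
  move=> bgE; exists D => t t0 i.
  have un j : u t j <= 0 by have := flow_udom t0 j; rewrite bgE => /ltW.
  rewrite ler0_norm// -sub0r; apply: key => // e.
  by rewrite bgE in e.
have eucc : bg = Euclidean -> exists B : R, forall t : R, 0 <= t -> forall i, `|u t i| <= B.
  move=> bgE; exists (`|\sum_i u 0 i| + D) => t t0 i.
  (* In Euclidean geometry constants are in the kernel of the symmetric Laplacian, so the sum of the
     velocities is 0. *)
  have St : \sum_i u t i = \sum_i u 0 i.
    have dS (x : R) : 0 <= x -> is_d (fun s => \sum_i u s i) x 0.
      move=> x0; apply: is_d_eq (is_d_sum predT (flow_vel x0)) _.
      have := lap_quad bg tau (u x) (kap bg tau k (u x)) (fun=> 1).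
      under eq_bigr do rewrite mul1r.
      rewrite /vel sumrN => ->; rewrite big1 ?oppr0// => d _.
      by rewrite bgE /= /vdiff subrr; ring.
    apply/eqP; rewrite eq_le; apply/andP; split.
    - apply: (ge_of_is_d (f := fun s => \sum_i u s i) (df := fun=> 0) t0) => // x /andP[x0 _].
      exact: dS.
    - apply: (le_of_is_d (f := fun s => \sum_i u s i) (df := fun=> 0) t0) => // x /andP[x0 _].
      exact: dS.
  case: (@arg_maxP _ _ _ i predT (u t) erefl) => j _ jmax.
  have Dj l : u t j - u t l <= D.
    by apply: key => // [m|e|_]; [exact: jmax|by rewrite bgE in e|exists j].
  have Dij l : `|u t i - u t l| <= D.
    have jm m : u t m <= u t j by exact: jmax.
    have := Dj i; have := Dj l; have := jm i; have := jm l.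
    by rewrite ler_norml => *; apply/andP; split; lra.
  have N1 : 1 <= N%:R :> R by rewrite ler1n (leq_trans _ (ltn_ord i)).
  have N0 : 0 < N%:R :> R by exact: lt_le_trans N1.
  rewrite -(ler_pM2l N0) -[X in X * `|_|](gtr0_norm N0) -normrM.
  (* The conserved mean converts the bound on oscillation into a bound on each coordinate. *)
  have -> : N%:R * u t i = \sum_l u 0 l + \sum_l (u t i - u t l).
    by rewrite sumrB St sumr_const card_ord mulr_natl; ring.
  apply: le_trans (ler_normD _ _) _; rewrite mulrDr; apply: lerD.
    by rewrite ler_peMl.
  apply: le_trans (ler_norm_sum _ _ _) _.
  apply: le_trans (ler_sum _ (fun l _ => Dij l)) _.
  by rewrite sumr_const card_ord [leRHS]mulr_natl.
by case E : bg; [exact: hypc|exact: eucc].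
Qed.

Lemma flow_upper : exists2 M : R, udom bg M &
  forall t : R, 0 <= t -> forall i, u t i <= M.
Proof.
have := flow_barrier; rewrite /udom; case: bg => [/(_ erefl)[eta eta0 H]|_].
  by exists (- eta); rewrite ?oppr_lt0.
have [B HB] := flow_bounded; exists B => // t t0 i.
exact: le_trans (ler_norm _) (HB t t0 i).
Qed.

Lemma flow_converges : exists us : 'I_N -> R, exists C mu : R,
  [/\ 0 < mu, forall i, udom bg (us i), forall i, kap bg tau k us i = 0 &
      forall t : R, 0 <= t -> forall i, `|u t i - us i| <= C * expR (- mu * t)].
Proof.
have [B uB] := flow_bounded.
have [lam lam0 gap] := lap_gap bg tau_gt0 B.
have [W W0 HW] := lap_bound bg tau_gt0.
have [L L0 HL] := kap_lip bg k tau_gt0.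
pose q (t : R) := \sum_i kap bg tau k (u t) i ^+ 2.
pose vq (t : R) := \sum_i vel bg tau k (u t) i ^+ 2.
have dq (t : R) : 0 <= t -> is_d q t (- 2 * vq t).
  move=> t0.
  have D i := is_d_sqr (is_d_kap bg tau k i (flow_vel t0)).
  apply: is_d_eq (is_d_sum predT D) _.
  rewrite /vq mulr_sumr.
  transitivity (2 * \sum_i kap bg tau k (u t) i * lap bg tau (u t) (vel bg tau k (u t)) i).
    by rewrite mulr_sumr; apply: eq_bigr => i _; rewrite mulrA.
  by rewrite lap_sym mulr_sumr; apply: eq_bigr => i _; rewrite /vel; ring.
(* A discrete Gauss-Bonnet identity, which makes the spectral gap applicable to the curvature
   defect. *)
have kap0 (t : R) : bg = Euclidean -> \sum_i kap bg tau k (u t) i = 0.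
  move=> bgE; have := kap_sum bg tau k (u t) (fun=> 1).
  under eq_bigr do rewrite mulr1.
  move=> ->; under eq_bigr do rewrite mulr1.
  rewrite [X in X + _](total bgE) -big_split big1// => d _ /=.
  by rewrite bgE /= /vsum /vdiff /th; ring.
(* The gap bounds [lam * q] by the pairing of the defect with its Laplacian; expanding the square of
   [lam * kap - lap kap] then compares with [vq]. *)
have gapq (t : R) : 0 <= t -> lam ^+ 2 * q t <= vq t.
  move=> t0; have := gap _ (uB t t0) _ (kap0 t); rewrite -/(q t) => h.
  have h2 : lam * (\sum_i kap bg tau k (u t) i * lap bg tau (u t) (kap bg tau k (u t)) i) <=
      lam ^+ 2 / 2 * q t + 2^-1 * vq t.
    rewrite /q /vq !mulr_sumr -big_split; apply: ler_sum => i _ /=.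
    have := sqr_ge0 (lam * kap bg tau k (u t) i - lap bg tau (u t) (kap bg tau k (u t)) i).
    rewrite /vel sqrrN; lra.
  have := ler_wpM2l (ltW lam0) h; lra.
pose mu := lam ^+ 2.
have mu0 : 0 < mu by rewrite exprn_gt0.
have qexp (t : R) : 0 <= t -> q t <= q 0 * expR (- (2 * mu) * t).
  move=> t0; apply: exp_decay dq _ t t0 => s s0 /=.
  by have := gapq s s0; rewrite -/mu; lra.
pose K := Num.sqrt (q 0).
have q0 : 0 <= q 0 by apply: sumr_ge0 => i _; exact: sqr_ge0.
have kapK (t : R) : 0 <= t -> forall i, `|kap bg tau k (u t) i| <= K * expR (- mu * t).
  move=> t0 i; rewrite -ler_sqr ?nnegrE ?mulr_ge0 ?expR_ge0 ?sqrtr_ge0//.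
  rewrite real_normK ?num_real// exprMn sqr_sqrtr//.
  have -> : expR (- mu * t) ^+ 2 = expR (- (2 * mu) * t).
    by rewrite expr2 -expRD; congr expR; ring.
  apply: le_trans (qexp t t0); rewrite /q (bigD1 i)//= lerDl.
  by apply: sumr_ge0 => j _; exact: sqr_ge0.
have velK (t : R) : 0 <= t -> forall i, `|vel bg tau k (u t) i| <= W * K * expR (- mu * t).
  by move=> t0 i; rewrite /vel normrN -mulrA; apply: HW => j; exact: kapK.
have /choice[us usP] : forall i, exists l : R, forall t : R, 0 <= t ->
    `|u t i - l| <= W * K / mu * expR (- mu * t).
  move=> i; apply: (@exp_convergence R (fun t => u t i) (fun t => vel bg tau k (u t) i)) => //.
  - by move=> t t0; exact: flow_vel.
  - by move=> t t0; exact: velK.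
pose C := W * K / mu.
have usP' (t : R) : 0 <= t -> forall i, `|u t i - us i| <= C * expR (- mu * t).
  by move=> t0 i; exact: usP.
exists us, C, mu; split=> // [i|i].
- case E : bg => //=.
  have [eta eta0 ueta] := flow_barrier E.
  apply: (@le_lt_trans _ _ (- eta)); last by rewrite oppr_lt0.
  apply: (@le_of_exp _ _ C mu) => // t t0.
  have := usP' t t0 i; rewrite ler_norml => /andP[h _]; have := ueta t t0 i; lra.
- apply/eqP; rewrite -normr_le0.
  apply: (@le_of_exp _ _ (K + L * C) mu) => // t t0; rewrite add0r mulrDl.
  (* Both terms on the right are of order [expR (- mu * t)], while the left side does not depend on
     [t]. *)
  have -> : kap bg tau k us i =
      kap bg tau k (u t) i - (kap bg tau k (u t) i - kap bg tau k us i) by ring.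
  apply: le_trans (ler_normB _ _) _; apply: lerD; first exact: kapK.
  rewrite -mulrA; apply: HL; last by move=> j; exact: usP'.
  by apply: le_trans (usP' t t0 i).
Qed.

End Solution.
End Convergence.

(** * Back to radii *)

Section Attainable.
Context {R : realType} (N : nat) (T : triangulation N).
Variables (Theta : tri_edge T -> R).
Local Notation dart := (tri_edge T * bool)%type.

Lemma touches_ends (A : {set 'I_N}) (d : dart) :
  touches A d = (edge_ends d.1 :&: A != finset.set0)%SET.
Proof.
case: d => e b; apply/idP/set0Pn => [|[x]].
  by case/orP; rewrite /tri_tgt /dart_rev/=; case: b => h;
    [exists (tri_src (e, true))|exists (tri_src (e, false))
    |exists (tri_src (e, false))|exists (tri_src (e, true))];
    rewrite !inE h eqxx ?orbT.
rewrite !inE /touches /tri_tgt /dart_rev/= => /andP[/orP[]/eqP -> h];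
  by case: b; rewrite /= h ?orbT.
Qed.

Lemma sum_touches (A : {set 'I_N}) : \sum_(d : dart | touches A d) Theta d.1 =
  2 * \sum_(e | (edge_ends e :&: A != finset.set0)%SET) Theta e.
Proof.
rewrite (eq_bigl (fun d : dart => (edge_ends d.1 :&: A != finset.set0)%SET && true)).
  rewrite -(pair_big (fun e => (edge_ends e :&: A != finset.set0)%SET) predT (fun e _ => Theta e)).
  by rewrite mulr_sumr; apply: eq_bigr => e _; rewrite big_bool /= mulrDl mul1r.
by move=> d; rewrite touches_ends andbT.
Qed.

(** Each edge carries two darts, which accounts for the factor 2 in [angle_bound]. *)
Lemma angle_boundE (k : 'rV[R]_N) (A : {set 'I_N}) :
  \sum_(i in A) (2 * pi - k 0 i) - \sum_(d : dart | touches A d) Theta d.1 =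
  angle_bound Theta A - \sum_(i in A) k 0 i.
Proof.
rewrite sumrB sumr_const sum_touches /angle_bound -[_ *+ _]mulr_natr; ring.
Qed.

End Attainable.

(** * One-sided derivatives at the initial time *)

Section OneSided.
Context {R : realType}.
Local Notation is_d f x d := (is_derive x (1 : R) f d).

Lemma within_dnbhs_epsP (f : R -> R) (t d : R) :
  (f s - f t) / (s - t) @[s --> within [set s : R | 0 <= s] t^'] --> d <->
  forall e : R, 0 < e -> exists2 dl : R, 0 < dl &
    forall s : R, 0 <= s -> s != t -> `|s - t| < dl -> `|d - (f s - f t) / (s - t)| < e.
Proof.
split=> [/cvgrPdist_lt H e e0|H].
  have /dnbhs_epsP[dl dl0 K] := H e e0.
  by exists dl => // s s0 st sd; exact: K.
apply/cvgrPdist_lt => e e0; have [dl dl0 K] := H e e0.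
apply/dnbhs_epsP; exists dl => // s st sd s0; exact: K.
Qed.

Lemma within_of_is_d (f : R -> R) (t d : R) : is_d f t d ->
  (f s - f t) / (s - t) @[s --> within [set s : R | 0 <= s] t^'] --> d.
Proof.
move=> /is_dP H; apply/within_dnbhs_epsP => e e0.
by have [dl dl0 K] := H e e0; exists dl => // s _; exact: K.
Qed.

(** Continuing [f] to negative times by its tangent line at 0 makes the one-sided derivative there
    two-sided, so the calculus above applies. *)
Lemma is_d_of_within (f df : R -> R) :
  (forall t : R, 0 <= t ->
    (f s - f t) / (s - t) @[s --> within [set s : R | 0 <= s] t^'] --> df t) ->
  forall t : R, 0 <= t ->
    is_d (fun s => if 0 <= s then f s else f 0 + s * df 0) t (df t).
Proof.
move=> H t t0; apply/is_dP => e e0; rewrite t0.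
have /within_dnbhs_epsP/(_ e e0)[dl dl0 K] := H t t0.
move: t0; rewrite le_eqVlt => /predU1P[t0|t0].
  exists dl => // s st sd; case: ifPn => [s0|s0]; first exact: K.
  rewrite -t0 subr0 in st *.
  have -> : (f 0 + s * df 0 - f 0) / s = df 0 by field.
  by rewrite subrr normr0.
exists (Num.min dl t); first by rewrite lt_min dl0.
move=> s st; rewrite lt_min => /andP[sd]; rewrite ltr_norml => /andP[s0 _].
have {}s0 : 0 <= s by lra.
by rewrite s0; exact: K.
Qed.

End OneSided.

Section Radius.
Context {R : realType}.
Local Notation is_d f x d := (is_derive x (1 : R) f d).

Lemma udom_le bg (x y : R) : x <= y -> udom bg y -> udom bg x.
Proof. by case: bg => //=; exact: le_lt_trans. Qed.

Lemma rspeed_radius_le bg (M : R) : udom bg M -> exists L : R,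
  forall x, x <= M -> rspeed bg (radius bg x) <= L.
Proof.
case: bg => /= HM; last by exists (expR M) => x xM; rewrite ler_expR.
exists (2 / (1 - expR M)) => x xM.
have E0 := expR_gt0 x; have xM' : expR x <= expR M by rewrite ler_expR.
have M1 : expR M < 1 by rewrite -expR0 ltr_expR.
rewrite /sinh expRN lnK ?posrE ?divr_gt0; [|lra..].
have -> : ((1 + expR x) / (1 - expR x) - ((1 + expR x) / (1 - expR x))^-1) / 2 =
    2 * expR x / (1 + expR x) / (1 - expR x).
  by field; rewrite !gt_eqF//; lra.
apply: ler_pM.
- by rewrite divr_ge0//; lra.
- by rewrite invr_ge0; lra.
- by rewrite ler_pdivrMr; lra.
- by rewrite lef_pV2 ?posrE; lra.
Qed.

(** Carries the exponential rate from u back to the radii. The level [M] is essential: in the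
    hyperbolic case the derivative sinh r blows up as u tends to 0. *)
Lemma radius_lip bg (M : R) : udom bg M -> exists2 L : R, 0 < L &
  forall x y, x <= M -> y <= M -> `|radius bg x - radius bg y| <= L * `|x - y|.
Proof.
move=> HM; have [L0 HL0] := rspeed_radius_le HM.
pose L := `|L0| + 1; have L1 : 0 < L by rewrite ltr_wpDl.
have HL x : x <= M -> rspeed bg (radius bg x) <= L.
  by move=> /HL0; have := ler_norm L0; rewrite /L; lra.
exists L => //.
have wl x y : x <= y -> y <= M -> `|radius bg x - radius bg y| <= L * `|x - y|.
  move=> xy yM.
  have D z : x <= z <= y -> is_d (radius bg) z (rspeed bg (radius bg z)).
    move=> /andP[_ zy]; apply: is_d_radius; apply: udom_le HM.
    exact: le_trans yM.
  have h1 : radius bg x <= radius bg y.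
    apply: (le_of_is_d xy D) => z /andP[_ zy].
    rewrite ltW// rspeed_gt0// radius_gt0//; apply: udom_le HM.
    exact: le_trans yM.
  have D2 z : x <= z <= y ->
      is_d (fun z => radius bg z - L * z) z (rspeed bg (radius bg z) - L * 1).
    by move=> /D Dz; exact: is_dB Dz (is_dZ L (is_d_id z)).
  have h2 : radius bg y - L * y <= radius bg x - L * x.
    apply: (ge_of_is_d xy D2) => z /andP[_ zy].
    by have := HL z (le_trans zy yM); lra.
  rewrite !ler0_norm ?subr_le0//; lra.
move=> x y xM yM; have [xy|/ltW yx] := leP x y; first exact: wl.
by rewrite distrC [`|x - y|]distrC; exact: wl.
Qed.

Lemma mx_norm_le (N : nat) (v : 'rV[R]_N) (c : R) : 0 <= c ->
  (forall i, `|v 0 i| <= c) -> `|v| <= c.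
Proof.
move=> c0 H; rewrite [`|v|]mx_normrE; apply/bigmax_leP; split=> // -[i j] _ /=.
by rewrite ord1.
Qed.

End Radius.

Section Main.
Context {R : realType} (bg : background) (N : nat) (T : triangulation N).
Variables (Theta : tri_edge T -> R) (k : 'rV[R]_N).
Hypothesis Theta_range : forall e, 0 < Theta e < pi.
Hypothesis attain : forall A : {set 'I_N}, A != finset.set0 ->
  (bg = Euclidean -> A != [set: 'I_N]%SET) ->
  angle_bound Theta A < \sum_(i in A) k 0 i.
Hypothesis total : bg = Euclidean ->
  angle_bound Theta [set: 'I_N]%SET = \sum_i k 0 i.
Hypothesis k_lt : forall i, k 0 i < 2 * pi.
Local Notation is_d f x d := (is_derive x (1 : R) f d).
Let tau e := tan (Theta e / 2).
Let kv i := k 0 i.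

Let tau_gt0 e : 0 < tau e.
Proof. exact: tan_half_gt0. Qed.

Let atan_tau e : 2 * atan (tau e) = Theta e.
Proof. by rewrite atan_tan_half//; field. Qed.

Let attain_darts (A : {set 'I_N}) : A != finset.set0 ->
  (bg = Euclidean -> A != [set: 'I_N]%SET) ->
  \sum_(i in A) (2 * pi - kv i) < \sum_(d | touches A d) 2 * atan (tau d.1).
Proof.
move=> A0 AT; under [ltRHS]eq_bigr do rewrite atan_tau.
by rewrite -subr_lt0 angle_boundE subr_lt0; exact: attain.
Qed.

Let total_darts : bg = Euclidean ->
  \sum_i (2 * pi - kv i) = \sum_(d : tri_edge T * bool) 2 * atan (tau d.1).
Proof.
move=> bgE; under [RHS]eq_bigr do rewrite atan_tau.
apply/eqP; rewrite -subr_eq0; apply/eqP.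
have := angle_boundE Theta k [set: 'I_N]%SET; rewrite (total bgE).
under [X in X - _ = _ -> _]eq_bigl do rewrite inE.
under [X in _ - X = _ -> _]eq_bigl do rewrite /touches !inE.
under [X in _ = _ - X -> _]eq_bigl do rewrite inE.
by rewrite subrr.
Qed.

Lemma flow_solution_converges (r0 : 'rV[R]_N) (r : R -> 'rV[R]_N) :
  flow_solution bg Theta k r0 r -> exists rs : 'rV[R]_N,
    [/\ positive_vec rs, converges_exponentially r rs &
        forall i, curvature bg Theta i rs = k 0 i].
Proof.
move=> [_ H].
pose rt i (s : R) := if 0 <= s then r s 0 i else r 0 0 i + s * flow_field bg Theta k (r 0) i.
have rtE i (t : R) : 0 <= t -> rt i t = r t 0 i by rewrite /rt => ->.
have drt i (t : R) : 0 <= t -> is_d (rt i) t (flow_field bg Theta k (r t) i).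
  move=> t0; apply: (@is_d_of_within R (fun s => r s 0 i)
    (fun s => flow_field bg Theta k (r s) i)) => // s s0.
  by have [_ ] := H s s0.
pose u (t : R) i := ucoord bg (rt i t).
have uE (t : R) : 0 <= t -> u t = (fun i => ucoord bg (r t 0 i)).
  by move=> t0; apply/funext => i; rewrite /u rtE.
have ud (t : R) : 0 <= t -> forall i, udom bg (u t i).
  by move=> t0 i; rewrite uE//; apply: ucoord_dom; have [] := H t t0.
have u_flow (t : R) : 0 <= t -> forall i,
    is_d (fun s => u s i) t (vel bg tau kv (clip bg (u t)) i).
  move=> t0 i; have [rp _] := H t t0.
  have P : 0 < rt i t by rewrite rtE.
  apply: is_d_eq (is_d_comp (drt i t t0) (is_d_ucoord bg P)) _.
  rewrite flow_fieldE// (clip_id (ud t t0)) rtE// uE//.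
  by rewrite mulrA mulVf ?mul1r// gt_eqF// rspeed_gt0.
have u_init : forall i, udom bg (u 0 i) by exact: ud.
have [us [C [mu [mu0 us_dom us_kap us_cvg]]]] :=
  flow_converges tau_gt0 attain_darts total_darts k_lt u_flow u_init.
pose rs : 'rV[R]_N := \row_i radius bg (us i).
have rs0 : positive_vec rs by move=> i; rewrite mxE radius_gt0.
exists rs; split=> //; last first.
  move=> i; rewrite (curvatureE bg k Theta_range)//.
  have -> : (fun i => ucoord bg (rs 0 i)) = us.
    by apply/funext => j; rewrite mxE radiusK.
  by rewrite us_kap add0r.
(* A level in the domain above both the trajectory and its limit, as [radius_lip] requires. *)
have [M MP] : exists M : 'I_N -> R, forall i, udom bg (M i) /\
    us i <= M i /\ forall t : R, 0 <= t -> u t i <= M i.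
  have [M0 M0d M0u] := flow_upper tau_gt0 attain_darts total_darts k_lt u_flow u_init.
  exists (fun i => Num.max M0 (us i)) => i; split.
    by rewrite /Num.max; case: ifP.
  split; first by rewrite le_max lexx orbT.
  by move=> t t0; rewrite le_max M0u.
have [||L L0 HL] := @finite_bound R 'I_N (fun i L => forall x y : R, x <= M i -> y <= M i ->
    `|radius bg x - radius bg y| <= L * `|x - y|).
- move=> i a b ab K x y xM yM; apply: le_trans (K x y xM yM) _; exact: ler_wpM2r.
- by move=> i; have [L _ HL] := radius_lip (MP i).1; exists L.
(* The sign of [C] is unknown, and the constant must be positive. *)
exists (L * (`|C| + 1)), mu; split=> //.
  by rewrite mulr_gt0// ltr_wpDl.
move=> t t0; apply: mx_norm_le.
  by rewrite !mulr_ge0 ?expR_ge0 ?(ltW L0)// addr_ge0.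
move=> i; rewrite !mxE.
have -> : r t 0 i = radius bg (u t i).
  by rewrite uE// ucoordK//; have [] := H t t0.
have [_ [h1 h2]] := MP i.
apply: le_trans (HL i _ _ (h2 t t0) h1) _.
rewrite -mulrA ler_pM2l//; apply: le_trans (us_cvg t t0 i) _.
by rewrite ler_wpM2r ?expR_ge0//; have := ler_norm C; lra.
Qed.

Lemma flow_solution_exists (r0 : 'rV[R]_N) : positive_vec r0 ->
  exists r, flow_solution bg Theta k r0 r.
Proof.
move=> r00; pose u0 i := ucoord bg (r0 0 i).
have [u [uE u_flow]] := lipschitz_ode u0 (fun i => bl_clip bg (bl_vel bg kv tau_gt0 i)).
have u_init : forall i, udom bg (u 0 i) by move=> i; rewrite uE; exact: ucoord_dom.
(* The solution constructed is that of the clipped system; since it stays in the domain, clipping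
   has no effect on it. *)
have ud := flow_udom tau_gt0 k_lt u_flow u_init.
have u_vel := flow_vel tau_gt0 k_lt u_flow u_init.
pose r (t : R) : 'rV[R]_N := \row_i radius bg (u t i).
have rp (t : R) : 0 <= t -> positive_vec (r t).
  by move=> t0 i; rewrite mxE; apply: radius_gt0; exact: ud.
exists r; split.
  by apply/rowP => i; rewrite mxE uE ucoordK.
move=> t t0; split; first exact: rp.
move=> i; apply: (within_of_is_d (f := fun s => r s 0 i)).
have -> : (fun s => r s 0 i) = (fun s => radius bg (u s i)).
  by apply/funext => s; rewrite mxE.
apply: is_d_eq (is_d_comp (u_vel t t0 i) (is_d_radius (ud t t0 i))) _.
rewrite (flow_fieldE bg k Theta_range); last exact: rp.
rewrite mxE; congr (_ * vel _ _ _ _ _).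
by apply/funext => j; rewrite mxE radiusK//; exact: ud.
Qed.

End Main.

Unset Implicit Arguments.

Theorem theorem1 (R : realType) (N g : nat) (T : triangulation N)
  (Theta : tri_edge T -> R)
  (genusT : euler_char T = 2 - 2 * g%:Z)
  (Theta_range : forall e, 0 < Theta e < pi)
  (C1 : cond_C1 Theta) :
  ((1 < g)%N ->
     forall k : 'rV[R]_N, hyperbolic_attainable Theta k ->
     forall r0 : 'rV[R]_N, positive_vec r0 ->
       (exists r, flow_solution Hyperbolic Theta k r0 r) /\
       (forall r, flow_solution Hyperbolic Theta k r0 r ->
          exists rs : 'rV[R]_N,
            [/\ positive_vec rs,
                converges_exponentially r rs &
                forall i, curvature Hyperbolic Theta i rs = k 0 i])) /\
  (g = 1%N ->
     forall k : 'rV[R]_N, euclidean_attainable Theta k ->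
     forall r0 : 'rV[R]_N, positive_vec r0 ->
       (exists r, flow_solution Euclidean Theta k r0 r) /\
       (forall r, flow_solution Euclidean Theta k r0 r ->
          exists rs : 'rV[R]_N,
            [/\ positive_vec rs,
                converges_exponentially r rs &
                forall i, curvature Euclidean Theta i rs = k 0 i])).
Proof.
split=> _ k [k_lt k_att] r0 r00; split.
- exact: flow_solution_exists.
- move=> r; apply: flow_solution_converges => // A A0 _.
  by apply: k_att; apply/eqP.
- exact: flow_solution_exists.
- move=> r; apply: flow_solution_converges => //.
  + move=> A A0 /(_ erefl) AT; have [|le_att eq_att] := k_att A; first exact/eqP.
    rewrite lt_neqAle le_att andbT; apply/eqP => E.
    by move/eqP: AT; apply; apply/eq_att.
  + move=> _; have [|_ [_ /(_ erefl) E]] := k_att [set: 'I_N]%SET.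
      (* The vertex set is nonempty because it contains an end of some edge. *)
      move=> E; have [e _] : exists e : tri_edge T, true.
        by have /card_gt0P[e _] := tri_nonempty T; exists e.
      by have := finset.in_set0 (tri_src (e, true)); rewrite -E inE.
    by rewrite -E; apply: eq_bigl => i; rewrite inE.
Qed.
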